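(* Let $d$ and $\delta$ be two derivations on $L=L^k$ such that: (1) $L=\ker_L d\oplus d(L)$; (2) $\ker_L d$ is stable by $\delta$; (3) the restriction of $\delta$ from $\ker_L d$ to $\ker_L d$ is invertible. Let $u\in L=L^k\subset L^{\mathcal A}$, where $\mathcal A=k[[\varepsilon]][\varepsilon^{-1}]$. Then the equation $$(d+\varepsilon\delta)\varphi=\varphi u$$ has a solution $\varphi=\varphi(\varepsilon)\in G^{\mathcal A}$ and, if $$\varphi=\varphi^-\varphi^+,\qquad (\varphi^-,\varphi^+)\in G^{\mathcal A^-}\times G^{\mathcal A^+},$$ is its Birkhoff decomposition, then the group-like element $\varphi^{\mathrm{ren}}=\varphi^+(\varepsilon)|_{\varepsilon=0}\in G^k$ $d$-conjugates $u$ to an element $\beta\in\ker_L d$, i.e. $d(\varphi^{\mathrm{ren}})+\beta\,\varphi^{\mathrm{ren}}=\varphi^{\mathrm{ren}}u$ with $d(\beta)=0$. Moreover, $\delta\varphi^-=\varphi^-(\varepsilon^{-1}\beta)$.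
   Context: Let $k$ be a field of characteristic $0$ and $\bigoplus_{n\ge1}L^k_n$ a graded Lie algebra over $k$ with finite-dimensional components and $[L^k_n,L^k_m]\subset L^k_{n+m}$; $L^k=\prod_{n\ge1}L^k_n$ is its completion, with the bracket extended componentwise. For a commutative $k$-algebra $\mathcal B$ (possibly without unit), $L^{\mathcal B}=\prod_{n\ge1}\mathcal B\otimes_k L^k_n$ with bracket induced by $[a\otimes x,b\otimes y]=(ab)\otimes[x,y]$. $\mathcal A=k[[\varepsilon]][\varepsilon^{-1}]$ is the algebra of Laurent series in $\varepsilon$; $\mathcal A=\mathcal A^-\oplus\mathcal A^+$ with subalgebras $\mathcal A^-=\varepsilon^{-1}k[\varepsilon^{-1}]$ and $\mathcal A^+=k[[\varepsilon]]$. Let $\mathcal U^k=\prod_{n\ge0}\mathcal U^k_n$ be the completion of the (graded) universal enveloping algebra of $\bigoplus_n L^k_n$, and $\mathcal U^{\mathcal A}=\prod_{n\ge0}\mathcal A\otimes\mathcal U^k_n$. $G^k$ (resp. $G^{\mathcal A}$) is the group of group-like elements of $\mathcal U^k$ (resp. $\mathcal U^{\mathcal A}$) for the coproduct with $\Delta(x)=1\otimes x+x\otimes1$ for $x$ in the Lie algebra; equivalently $G^k=\exp(L^k)$, $G^{\mathcal A}=\exp(L^{\mathcal A})$. Likewise $G^{\mathcal A^\pm}=\exp(L^{\mathcal A^\pm})\subset G^{\mathcal A}$. Every $\varphi\in G^{\mathcal A}$ admits a unique Birkhoff decomposition $\varphi=\varphi^-\varphi^+$ with $\varphi^\pm\in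 G^{\mathcal A^\pm}$. Evaluation at $\varepsilon=0$ is done coefficientwise. A derivation on $L$ is a graded $k$-linear endomorphism $d$ (so $d(L_n)\subset L_n$, acting componentwise) with $d([x,y])=[d(x),y]+[x,d(y)]$. It extends to $L^{\mathcal A}$ by $\mathcal A$-linearity, and to the completed enveloping algebra as a graded derivation with $d(1)=0$ and $d(xy)=d(x)y+x\,d(y)$. $\ker_L d=\ker d\cap L$. An element $\varphi\in G^k$ $d$-conjugates $u\in L$ to $v\in L$ if $d(\varphi)+v\varphi=\varphi u$; a $d$-normal form of $u$ is an element of $\ker_L d$ to which $u$ is $d$-conjugate. *)

(* Defs.v *)
From HB Require Import structures.
From mathcomp Require Import all_boot all_order all_algebra generic_quotient.
From mathcomp Require Import boolp classical_sets functions fsbigop.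

Set Implicit Arguments.
Unset Strict Implicit.
Unset Printing Implicit Defensive.

Import Order.TTheory GRing.Theory Num.Theory.

Local Open Scope classical_set_scope.
Local Open Scope ring_scope.
Local Open Scope quotient_scope.

(** * Associative unital algebras given by generators and relations

  [presented rel] is the unital associative k-algebra generated by X subject
  to the relations [rel]: formal expressions modulo the smallest congruence
  that contains [rel] and the axioms of k-algebras. It may be the zero
  algebra, hence pzRingType instead of nzRingType. *)

Section Terms.
Variables (k : fieldType) (X : Type).

Inductive term :=
| Gen of X
| Cst of k
| Add of term & term
| Mul of term & term.

HB.instance Definition _ := gen_eqMixin term.
HB.instance Definition _ := gen_choiceMixin term.

Variable rel : term -> term -> Prop.

Inductive cong : term -> term -> Prop :=
| cong_rel s t : rel s t -> cong s t
| cong_refl s : cong s s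
| cong_sym s t : cong s t -> cong t s
| cong_trans s t r : cong s t -> cong t r -> cong s r
| cong_Add s s' t t' : cong s s' -> cong t t' -> cong (Add s t) (Add s' t')
| cong_Mul s s' t t' : cong s s' -> cong t t' -> cong (Mul s t) (Mul s' t')
| cong_addA s t r : cong (Add s (Add t r)) (Add (Add s t) r)
| cong_addC s t : cong (Add s t) (Add t s)
| cong_add0 s : cong (Add (Cst 0) s) s
| cong_addN s : cong (Add (Mul (Cst (-1)) s) s) (Cst 0)
| cong_mulA s t r : cong (Mul s (Mul t r)) (Mul (Mul s t) r)
| cong_mul1 s : cong (Mul (Cst 1) s) s
| cong_mulDl s t r : cong (Mul (Add s t) r) (Add (Mul s r) (Mul t r))
| cong_mulDr s t r : cong (Mul r (Add s t)) (Add (Mul r s) (Mul r t))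
| cong_CstD a b : cong (Cst (a + b)) (Add (Cst a) (Cst b))
| cong_CstM a b : cong (Cst (a * b)) (Mul (Cst a) (Cst b))
| cong_CstC a s : cong (Mul (Cst a) s) (Mul s (Cst a)).

Definition congb (s t : term) : bool := `[< cong s t >].

Lemma congb_refl : reflexive congb.
Proof. by move=> s; apply/asboolP; exact: cong_refl. Qed.

Lemma congb_sym : symmetric congb.
Proof. by move=> s t; apply/asboolP/asboolP; exact: cong_sym. Qed.

Lemma congb_trans : transitive congb.
Proof.
by move=> t s r /asboolP st /asboolP tr; apply/asboolP; apply: cong_trans st tr.
Qed.

Canonical congb_equiv := EquivRel congb congb_refl congb_sym congb_trans.

Definition presented := {eq_quot congb_equiv}.
HB.instance Definition _ := EqQuotient.on presented.
HB.instance Definition _ := Choice.on presented.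

Definition pcls (t : term) : presented := \pi_presented t.
Definition pgen (x : X) : presented := pcls (Gen x).

Lemma pclsP s t : pcls s = pcls t <-> cong s t.
Proof.
split; first by move=> /eqmodP /asboolP.
by move=> st; apply/eqmodP/asboolP.
Qed.

Lemma pcls_repr (a : presented) : pcls (repr a) = a.
Proof. exact: reprK. Qed.

Lemma cong_repr t : cong (repr (pcls t)) t.
Proof. by apply/pclsP; rewrite pcls_repr. Qed.

Definition padd (a b : presented) := pcls (Add (repr a) (repr b)).
Definition pmul (a b : presented) := pcls (Mul (repr a) (repr b)).
Definition pscale (c : k) (a : presented) := pmul (pcls (Cst c)) a.

Lemma paddE s t : padd (pcls s) (pcls t) = pcls (Add s t).
Proof. by apply/pclsP; apply: cong_Add; exact: cong_repr. Qed.

Lemma pmulE s t : pmul (pcls s) (pcls t) = pcls (Mul s t).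
Proof. by apply/pclsP; apply: cong_Mul; exact: cong_repr. Qed.

Lemma pclsW (P : presented -> Prop) : (forall t, P (pcls t)) -> forall a, P a.
Proof. by move=> H a; rewrite -(pcls_repr a); exact: H. Qed.

Lemma paddA : associative padd.
Proof.
elim/pclsW=> s; elim/pclsW=> t; elim/pclsW=> r.
by rewrite !paddE; apply/pclsP; exact: cong_addA.
Qed.

Lemma paddC : commutative padd.
Proof.
elim/pclsW=> s; elim/pclsW=> t.
by rewrite !paddE; apply/pclsP; exact: cong_addC.
Qed.

Lemma padd0 : left_id (pcls (Cst 0)) padd.
Proof. by elim/pclsW=> s; rewrite !paddE; apply/pclsP; exact: cong_add0. Qed.

Lemma paddN : left_inverse (pcls (Cst 0)) (pscale (-1)) padd.
Proof.
elim/pclsW=> s; rewrite /pscale pmulE paddE.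
by apply/pclsP; exact: cong_addN.
Qed.

HB.instance Definition _ :=
  GRing.isZmodule.Build presented paddA paddC padd0 paddN.

Lemma pmulA : associative pmul.
Proof.
elim/pclsW=> s; elim/pclsW=> t; elim/pclsW=> r.
by rewrite !pmulE; apply/pclsP; exact: cong_mulA.
Qed.

Lemma pmul1 : left_id (pcls (Cst 1)) pmul.
Proof. by elim/pclsW=> s; rewrite !pmulE; apply/pclsP; exact: cong_mul1. Qed.

Lemma pmulCst c (a : presented) : pmul (pcls (Cst c)) a = pmul a (pcls (Cst c)).
Proof.
by elim/pclsW: a => s; rewrite !pmulE; apply/pclsP; exact: cong_CstC.
Qed.

Lemma pmulr1 : right_id (pcls (Cst 1)) pmul.
Proof. by move=> a; rewrite -pmulCst pmul1. Qed.

Lemma pmulDl : left_distributive pmul padd.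
Proof.
elim/pclsW=> s; elim/pclsW=> t; elim/pclsW=> r.
by rewrite paddE !pmulE paddE; apply/pclsP; exact: cong_mulDl.
Qed.

Lemma pmulDr : right_distributive pmul padd.
Proof.
elim/pclsW=> s; elim/pclsW=> t; elim/pclsW=> r.
by rewrite paddE !pmulE paddE; apply/pclsP; exact: cong_mulDr.
Qed.

HB.instance Definition _ :=
  GRing.Zmodule_isPzRing.Build presented pmulA pmul1 pmulr1 pmulDl pmulDr.

Lemma pscaleA a b (v : presented) : pscale a (pscale b v) = pscale (a * b) v.
Proof.
rewrite /pscale pmulA pmulE; congr pmul.
by apply/pclsP; apply: cong_sym; exact: cong_CstM.
Qed.

Lemma pscaleDl (v : presented) : {morph pscale^~ v : a b / a + b >-> padd a b}.
Proof.
move=> a b; rewrite /pscale -pmulDl paddE; congr pmul.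
by apply/pclsP; exact: cong_CstD.
Qed.

HB.instance Definition _ := GRing.Zmodule_isLmodule.Build k presented
  pscaleA pmul1 (fun c => pmulDr (pcls (Cst c))) pscaleDl.

Lemma pscaleAl c (a b : presented) : c *: (a * b) = c *: a * b.
Proof. exact: pmulA. Qed.

Lemma pscaleAr c (a b : presented) : c *: (a * b) = a * (c *: b).
Proof.
change (pmul (pcls (Cst c)) (pmul a b) = pmul a (pmul (pcls (Cst c)) b)).
by rewrite !pmulA pmulCst.
Qed.

Lemma pclsD s t : pcls s + pcls t = pcls (Add s t).
Proof. exact: paddE. Qed.

Lemma pclsM s t : pcls s * pcls t = pcls (Mul s t).
Proof. exact: pmulE. Qed.

Lemma pclsZ c s : c *: pcls s = pcls (Mul (Cst c) s).
Proof. exact: pmulE. Qed.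

Lemma pclsC c : pcls (Cst c) = c *: (1 : presented).
Proof. by symmetry; exact: pmulr1. Qed.

End Terms.

Arguments Cst {k X}.

Section Lift.
Variables (k : fieldType) (X Y : Type).
Variables (relX : term k X -> term k X -> Prop).
Variables (relY : term k Y -> term k Y -> Prop).
Variable f : X -> presented relY.

Fixpoint teval (t : term k X) : presented relY :=
  match t with
  | Gen x => f x
  | Cst c => c *: (1 : presented relY)
  | Add s t => teval s + teval t
  | Mul s t => teval s * teval t
  end.

Definition plift (a : presented relX) : presented relY := teval (repr a).

Hypothesis f_rel : forall s t, relX s t -> teval s = teval t.

Lemma teval_cong s t : cong relX s t -> teval s = teval t.
Proof.
elim=> //=.
- by move=> {}s {}t r _ -> _ ->.
- by move=> s1 s2 t1 t2 _ -> _ ->.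
- by move=> s1 s2 t1 t2 _ -> _ ->.
- by move=> *; rewrite addrA.
- by move=> *; rewrite addrC.
- by move=> *; rewrite scale0r add0r.
- by move=> *; rewrite -pscaleAl mul1r scaleN1r addNr scale0r.
- by move=> *; rewrite mulrA.
- by move=> *; rewrite scale1r mul1r.
- by move=> *; rewrite mulrDl.
- by move=> *; rewrite mulrDr.
- by move=> *; rewrite scalerDl.
- by move=> *; rewrite -pscaleAl mul1r scalerA.
- by move=> *; rewrite -pscaleAl -pscaleAr mul1r mulr1.
Qed.

Lemma plift_cls t : plift (pcls relX t) = teval t.
Proof. by apply: teval_cong; exact: cong_repr. Qed.

Lemma plift_gen x : plift (pgen relX x) = f x.
Proof. exact: plift_cls. Qed.

Lemma plift_linear : linear plift.
Proof.
move=> c; elim/pclsW=> s; elim/pclsW=> t.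
by rewrite pclsZ pclsD !plift_cls /= -pscaleAl mul1r.
Qed.

Lemma plift1 : plift 1 = 1.
Proof.
by rewrite -[1 in LHS](scale1r (1 : presented relX)) -pclsC plift_cls; exact: scale1r.
Qed.

Lemma pliftM : {morph plift : a b / a * b}.
Proof. by elim/pclsW=> s; elim/pclsW=> t; rewrite pclsM !plift_cls. Qed.

End Lift.

(** * Graded Lie algebras

  The direct sum of the L_n is a Lie algebra with an internal grading
  [lie_comp]; index 0 is allowed, with trivial component, so that the same
  completions serve for the enveloping algebra. *)

Record graded_lie (k : fieldType) := GradedLie {
  lie_sort :> lmodType k;
  lie_br : lie_sort -> lie_sort -> lie_sort;
  lie_brl : forall c x y z,
    lie_br (c *: x + y) z = c *: lie_br x z + lie_br y z;
  lie_brr : forall c x y z,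
    lie_br x (c *: y + z) = c *: lie_br x y + lie_br x z;
  lie_brxx : forall x, lie_br x x = 0;
  lie_jacobi : forall x y z,
    lie_br x (lie_br y z) + lie_br y (lie_br z x) + lie_br z (lie_br x y) = 0;
  lie_comp : nat -> set lie_sort;
  lie_comp0 : forall x, lie_comp 0 x -> x = 0;
  lie_comp_fin : forall n, exists s : seq lie_sort, forall x,
    lie_comp n x <-> exists c : nat -> k, x = \sum_(i < size s) c i *: s`_i;
  lie_comp_br : forall n m x y,
    lie_comp n x -> lie_comp m y -> lie_comp (n + m) (lie_br x y);
  lie_comp_gen : forall x, exists N (y : nat -> lie_sort),
    (forall n, lie_comp n (y n)) /\ x = \sum_(n < N) y n;
  lie_comp_free : forall N (y : nat -> lie_sort),
    (forall n, lie_comp n (y n)) -> \sum_(n < N) y n = 0 ->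
    forall n, (n < N)%N -> y n = 0
}.

(** A derivation of the completion \prod_n L_n that is graded and acts
  componentwise is the same as a graded derivation of the direct sum. *)

Record derivation (k : fieldType) (L : graded_lie k) := Derivation {
  der_fun :> {linear L -> L};
  der_comp : forall n x, lie_comp n x -> lie_comp n (der_fun x);
  der_br : forall x y,
    der_fun (lie_br x y) = lie_br (der_fun x) y + lie_br x (der_fun y)
}.

(** * The universal enveloping algebra and its coproduct *)

Section Enveloping.
Variables (k : fieldType) (L : graded_lie k).

Inductive urel : term k L -> term k L -> Prop :=
| urelD x y : urel (Gen k (x + y)) (Add (Gen k x) (Gen k y))
| urelZ c x : urel (Gen k (c *: x)) (Mul (Cst c) (Gen k x))
| urelB x y : urel (Add (Gen k (lie_br x y)) (Mul (Gen k y) (Gen k x)))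
                   (Mul (Gen k x) (Gen k y)).

Notation U := (presented urel).

Definition iota (x : L) : U := pgen urel x.

Lemma iotaP c x y : iota (c *: x + y) = c *: iota x + iota y.
Proof.
rewrite /iota /pgen pclsZ pclsD; apply/pclsP.
apply: cong_trans (cong_rel (urelD _ _)) _.
by apply: cong_Add (cong_refl _ _); exact: cong_rel (urelZ _ _).
Qed.

Lemma iota_br x y : iota (lie_br x y) = iota x * iota y - iota y * iota x.
Proof.
apply/eqP; rewrite eq_sym subr_eq eq_sym; apply/eqP.
by rewrite /iota /pgen !pclsM pclsD; apply/pclsP; exact: cong_rel (urelB _ _).
Qed.

Lemma iotaD x y : iota (x + y) = iota x + iota y.
Proof. by have := iotaP 1 x y; rewrite !scale1r. Qed.

Lemma iota0 : iota 0 = 0.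
Proof. by apply: (addrI (iota 0)); rewrite -iotaD !addr0. Qed.

Lemma iotaZ c x : iota (c *: x) = c *: iota x.
Proof. by have := iotaP c x 0; rewrite iota0 !addr0. Qed.

Inductive ucomp : nat -> set U :=
| ucomp0 n : ucomp n 0
| ucomp1 : ucomp 0 1
| ucompM n m x a : lie_comp n x -> ucomp m a -> ucomp (n + m) (iota x * a)
| ucompP n c a b : ucomp n a -> ucomp n b -> ucomp n (c *: a + b).

(** U (x) U, as the algebra generated by two commuting copies [inl a], [inr a]
  of U; the pure tensor of a and b is the product of [inl a] and [inr b]. *)

Inductive trel : term k (U + U) -> term k (U + U) -> Prop :=
| trel_lD a b : trel (Gen k (inl (a + b))) (Add (Gen k (inl a)) (Gen k (inl b)))
| trel_lM a b : trel (Gen k (inl (a * b))) (Mul (Gen k (inl a)) (Gen k (inl b)))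
| trel_lC c : trel (Gen k (inl (c *: (1 : U)))) (Cst c)
| trel_rD a b : trel (Gen k (inr (a + b))) (Add (Gen k (inr a)) (Gen k (inr b)))
| trel_rM a b : trel (Gen k (inr (a * b))) (Mul (Gen k (inr a)) (Gen k (inr b)))
| trel_rC c : trel (Gen k (inr (c *: (1 : U)))) (Cst c)
| trel_comm a b : trel (Mul (Gen k (inl a)) (Gen k (inr b)))
                       (Mul (Gen k (inr b)) (Gen k (inl a))).

Notation UU := (presented trel).

Definition tens (a b : U) : UU := pgen trel (inl a) * pgen trel (inr b).

Lemma tensDl a a' b : tens (a + a') b = tens a b + tens a' b.
Proof.
rewrite /tens -mulrDl; congr (_ * _); rewrite /pgen pclsD; apply/pclsP.
exact: cong_rel (trel_lD _ _).
Qed.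

Lemma tensDr a b b' : tens a (b + b') = tens a b + tens a b'.
Proof.
rewrite /tens -mulrDr; congr (_ * _); rewrite /pgen pclsD; apply/pclsP.
exact: cong_rel (trel_rD _ _).
Qed.

Lemma pgen_inl1 : pgen trel (inl 1) = 1.
Proof.
rewrite -[RHS](scale1r (1 : UU)) -pclsC -(scale1r (1 : U)); apply/pclsP.
exact: cong_rel (trel_lC _).
Qed.

Lemma pgen_inr1 : pgen trel (inr 1) = 1.
Proof.
rewrite -[RHS](scale1r (1 : UU)) -pclsC -(scale1r (1 : U)); apply/pclsP.
exact: cong_rel (trel_rC _).
Qed.

Lemma tensZl c a b : tens (c *: a) b = c *: tens a b.
Proof.
rewrite /tens pscaleAl; congr (_ * _).
rewrite -[a in LHS]mul1r pscaleAl /pgen pclsZ; apply/pclsP.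
apply: cong_trans (cong_rel (trel_lM _ _)) _.
by apply: cong_Mul (cong_refl _ _); exact: cong_rel (trel_lC _).
Qed.

Lemma tensZr c a b : tens a (c *: b) = c *: tens a b.
Proof.
rewrite /tens pscaleAr; congr (_ * _).
rewrite -[b in LHS]mul1r pscaleAl /pgen pclsZ; apply/pclsP.
apply: cong_trans (cong_rel (trel_rM _ _)) _.
by apply: cong_Mul (cong_refl _ _); exact: cong_rel (trel_rC _).
Qed.

Lemma tensM a b a' b' : tens a b * tens a' b' = tens (a * a') (b * b').
Proof.
rewrite /tens /pgen !pclsM; apply/pclsP.
set A := Gen k (inl a); set B := Gen k (inr b).
set A' := Gen k (inl a'); set B' := Gen k (inr b').
apply: cong_trans (cong_Mul (cong_sym (cong_rel (trel_lM a a')))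
  (cong_sym (cong_rel (trel_rM b b')))); rewrite -/A -/A' -/B -/B'.
apply: cong_trans (cong_sym (cong_mulA _ A B (Mul A' B'))) _.
apply: cong_trans (cong_mulA _ A A' (Mul B B')).
apply: cong_Mul (cong_refl _ _) _.
apply: cong_trans (cong_mulA _ B A' B') _.
apply: cong_trans (cong_sym (cong_mulA _ A' B B')).
by apply: cong_Mul (cong_refl _ _); apply: cong_sym; exact: cong_rel (trel_comm _ _).
Qed.

Definition coprod : U -> UU :=
  plift (relX := urel) (fun x => tens 1 (iota x) + tens (iota x) 1).

Let coprod_rel s t : urel s t ->
  teval (fun x => tens 1 (iota x) + tens (iota x) 1) s =
  teval (fun x => tens 1 (iota x) + tens (iota x) 1) t.
Proof.
case=> [x y|c x|x y] /=.
- by rewrite iotaD tensDl tensDr addrACA.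
- by rewrite iotaZ tensZl tensZr -scalerDr -pscaleAl mul1r.
rewrite !mulrDl !mulrDr !tensM !mul1r !mulr1 iota_br.
rewrite tensDl tensDr -!scaleN1r tensZl tensZr !scaleN1r.
have E (V : zmodType) (p q r v a b : V) :
  p - q + (r - v) + (q + a + (b + v)) = p + b + (a + r).
  rewrite addrACA (addrA (p - q)) subrK [b + v]addrC (addrA (r - v)) subrK.
  by rewrite [r + b]addrC addrACA.
exact: E.
Qed.

Lemma coprod_linear : linear coprod.
Proof. exact: plift_linear coprod_rel. Qed.

Lemma coprod1 : coprod 1 = 1.
Proof. exact: plift1 coprod_rel. Qed.

Lemma coprodM : {morph coprod : a b / a * b}.
Proof. exact: pliftM coprod_rel. Qed.

Lemma coprod_iota x : coprod (iota x) = tens 1 (iota x) + tens (iota x) 1.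
Proof. exact: plift_gen coprod_rel x. Qed.

(** Extension of a derivation to U. *)

Variable d : derivation L.

Fixpoint tder (t : term k L) : term k L :=
  match t with
  | Gen x => Gen k (d x)
  | Cst c => Cst 0
  | Add s t => Add (tder s) (tder t)
  | Mul s t => Add (Mul (tder s) t) (Mul s (tder t))
  end.

Definition uder (a : U) : U := pcls urel (tder (repr a)).

Let cls0 : pcls urel (Cst 0) = 0. Proof. by []. Qed.

Let tder_cong s t :
  cong urel s t -> pcls urel (tder s) = pcls urel (tder t).
Proof.
elim=> //=.
- move=> _ _ [x y|c x|x y] /=.
  + by rewrite linearD -pclsD -!/(pgen urel _) -!/(iota _) iotaD.
  + rewrite linearZ -pclsD -!pclsM -!/(pgen urel _) -!/(iota _) iotaZ.
    by rewrite cls0 mul0r add0r pclsC -pscaleAl mul1r.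
  + rewrite der_br -!pclsD -!pclsM -!/(pgen urel _) -!/(iota _) iotaD !iota_br.
    have E (V : zmodType) (p q r v : V) : p - q + (r - v) + (v + q) = p + r.
      by rewrite (addrACA p) -opprD [q + v]addrC subrK.
    exact: E.
- by move=> {}s {}t r _ -> _ ->.
- by move=> s1 s2 t1 t2 _ h _ h'; rewrite -!pclsD h h'.
- move=> s1 s2 t1 t2 /pclsP e h /pclsP e' h'.
  by rewrite -!pclsD -!pclsM h h' e e'.
- by move=> *; rewrite -!pclsD addrA.
- by move=> *; rewrite -!pclsD addrC.
- by move=> *; rewrite -!pclsD cls0 add0r.
- move=> r; rewrite -!pclsD -!pclsM cls0 mul0r add0r pclsC.
  by rewrite -pscaleAl mul1r scaleN1r addNr.
- move=> a b c; rewrite -!(pclsD, pclsM) !mulrDl !mulrDr !mulrA.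
  by rewrite addrA.
- by move=> r; rewrite -!(pclsD, pclsM) cls0 mul0r add0r pclsC scale1r mul1r.
- by move=> a b c; rewrite -!(pclsD, pclsM) !mulrDl addrACA.
- by move=> a b c; rewrite -!(pclsD, pclsM) !mulrDr addrACA.
- by move=> *; rewrite -!pclsD cls0 addr0.
- by move=> *; rewrite -!(pclsD, pclsM) cls0 mul0r mulr0 addr0.
- move=> a r; rewrite -!(pclsD, pclsM) cls0 mul0r mulr0 add0r addr0 pclsC.
  by rewrite -pscaleAl -pscaleAr mul1r mulr1.
Qed.

Let uder_cls t : uder (pcls urel t) = pcls urel (tder t).
Proof. by apply: tder_cong; exact: cong_repr. Qed.

Lemma uder_iota x : uder (iota x) = iota (d x).
Proof. exact: uder_cls. Qed.

Lemma uder_linear : linear uder.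
Proof.
move=> c; elim/pclsW=> s; elim/pclsW=> t.
rewrite pclsZ pclsD !uder_cls /= -!(pclsD, pclsM) cls0 mul0r add0r pclsC.
by rewrite -pscaleAl mul1r.
Qed.

Lemma uder1 : uder 1 = 0.
Proof. by rewrite -(scale1r (1 : U)) -pclsC uder_cls. Qed.

Lemma uderM a b : uder (a * b) = uder a * b + a * uder b.
Proof.
elim/pclsW: a => s; elim/pclsW: b => t.
by rewrite pclsM !uder_cls /= -!(pclsD, pclsM).
Qed.

End Enveloping.

(** * Completions

  An element of \prod_n V_n is a function x : nat -> V with x n in V_n. Since
  every V_n in sight (a component of L, or of its enveloping algebra) is
  finite-dimensional, A (x) V_n, for A the Laurent series in eps, is the space
  of Laurent series with coefficients in V_n. An element of
  \prod_n (A (x) V_n) is thus a function x : nat -> int -> V, where x n m in V_n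
  is the coefficient of eps ^ m in the component of degree n; the order of the
  pole may depend on n. *)

Section Completion.
Variables (k : fieldType) (V : lmodType k) (gr : nat -> set V).

Definition compl : set (nat -> V) := [set x | forall n, gr n (x n)].

Definition laurent : set (nat -> int -> V) :=
  [set x | forall n, (forall m, gr n (x n m)) /\
                     exists N : int, forall m, m < N -> x n m = 0].

(** Coefficients in eps^-1 k[eps^-1], and in k[[eps]]. *)
Definition laurent_minus : set (nat -> int -> V) :=
  [set x | laurent x /\ forall n m, 0 <= m -> x n m = 0].

Definition laurent_plus : set (nat -> int -> V) :=
  [set x | laurent x /\ forall n m, m < 0 -> x n m = 0].

(** x |-> eps ^ j x, from \prod_n V_n and on \prod_n (A (x) V_n). *)
Definition eps_const (j : int) (x : nat -> V) : nat -> int -> V :=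
  fun n m => if m == j then x n else 0.

Definition eps_mul (j : int) (x : nat -> int -> V) : nat -> int -> V :=
  fun n m => x n (m - j).

Definition eval0 (x : nat -> int -> V) : nat -> V := fun n => x n 0.

End Completion.

(** Extension to completions of a bilinear [op : V -> V -> W]; the sum over
  p has finite support as soon as x and y are in [laurent]. *)

Definition conv (V : Type) (W : zmodType) (op : V -> V -> W) (x y : nat -> V)
    : nat -> W :=
  fun n => \sum_(i < n.+1) op (x i) (y (n - i)%N).

Definition convA (V : Type) (W : zmodType) (op : V -> V -> W)
    (x y : nat -> int -> V) : nat -> int -> W :=
  fun n m => \sum_(i < n.+1)
    \sum_(p \in [set: int]) op (x i p) (y (n - i)%N (m - p)).

Section Groups.
Variables (k : fieldType) (L : graded_lie k).

Notation U := (presented (@urel k L)).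
Notation Lk := (compl (@lie_comp k L)).

Definition uk_mul : (nat -> U) -> (nat -> U) -> nat -> U := conv *%R.

Definition ua_mul : (nat -> int -> U) -> (nat -> int -> U) -> nat -> int -> U :=
  convA *%R.

Definition ua_one : nat -> int -> U := fun n m => ((n == 0%N) && (m == 0))%:R.

(** Group-like: counit 1 (the counit is the component in U_0 = k), and
  coproduct of x equal to x (x) x. *)

Definition Gk : set (nat -> U) :=
  [set x | [/\ compl (@ucomp k L) x, x 0%N = 1 &
               forall n, coprod (x n) = conv (@tens k L) x x n]].

Definition GA : set (nat -> int -> U) :=
  [set x | [/\ laurent (@ucomp k L) x, x 0%N = ua_one 0%N &
               forall n m, coprod (x n m) = convA (@tens k L) x x n m]].

(** x ^ r has no component of degree less than r when x is in L^A. *)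
Definition ua_exp (x : nat -> int -> U) : nat -> int -> U :=
  fun n m => \sum_(r < n.+1) (r`!%:R : k)^-1 *: iter r (ua_mul x) ua_one n m.

Definition iota_k (x : nat -> L) : nat -> U := fun n => iota (x n).
Definition iota_A (x : nat -> int -> L) : nat -> int -> U :=
  fun n m => iota (x n m).

Definition GA_minus : set (nat -> int -> U) :=
  [set ua_exp (iota_A x) | x in laurent_minus (@lie_comp k L)].

Definition GA_plus : set (nat -> int -> U) :=
  [set ua_exp (iota_A x) | x in laurent_plus (@lie_comp k L)].

Definition birkhoff (phi phim phip : nat -> int -> U) :=
  [/\ GA_minus phim, GA_plus phip & phi = ua_mul phim phip].

Variable d : derivation L.

Definition der_k (x : nat -> L) : nat -> L := fun n => d (x n).
Definition uder_k (x : nat -> U) : nat -> U := fun n => uder d (x n).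
Definition uder_A (x : nat -> int -> U) : nat -> int -> U :=
  fun n m => uder d (x n m).

Definition kerL : set (nat -> L) := [set x | Lk x /\ der_k x = 0].

(** L = ker_L d (+) d(L) *)
Definition ker_im_split :=
  (forall x, Lk x -> exists y z, [/\ kerL y, Lk z & x = y + der_k z]) /\
  kerL `&` (der_k @` Lk) = [set 0].

Definition d_conjugates (phi : nat -> U) (u v : nat -> L) :=
  Gk phi /\ uder_k phi + uk_mul (iota_k v) phi = uk_mul phi (iota_k u).

End Groups.

(* Main.v *)
From HB Require Import structures.
Require Import Defs.
From mathcomp Require Import all_boot all_order all_algebra.
From mathcomp Require Import boolp classical_sets functions fsbigop.
From mathcomp Require Import zify.

Set Implicit Arguments.
Unset Strict Implicit.
Unset Printing Implicit Defensive.

Import Order.TTheory GRing.Theory Num.Theory.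
Local Open Scope classical_set_scope.
Local Open Scope ring_scope.

(** Let E be the Euler derivation, which multiplies the component of degree n
  by n. In characteristic 0 an element phi with phi_0 = 1 is determined by
  w = phi^-1 E(phi), since E(phi) = phi w reads n phi_n = (a sum over lower
  components), and phi is group-like when w has Lie coefficients: both
  Delta(phi) and phi (x) phi solve E(psi) = psi Delta(w) ([eul_grouplike]). So
  the group can be handled through logarithmic derivatives, by recursions that
  are linear in the unknown. The basic tool is [zero_curvature]: if a
  derivation D commutes with E, then D(phi) = phi v follows from the relation
  E(v) = D(w) + [v, w].

  Existence. With D = d + eps delta, the zero-curvature relation for v = u is
  D(w) = E(u) + [w, u]. It can be solved for w degree by degree, because D is
  onto on Laurent series with coefficients in L_n ([laurent_solve]): modulo
  ker d one inverts d and corrects by powers of eps, and on ker d one inverts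
  eps delta, which costs one power of eps. The phi with E(phi) = phi w is the
  solution.

  Renormalization. Write phi^- = exp(X). By [pexp_logder], d(phi^-) = phi^- a
  and delta(phi^-) = phi^- b with a and b in L^{A^-}. Put z = a + eps b. Then
  D(phi) = phi u becomes z phi^+ + D(phi^+) = phi^+ u, so z has no negative
  power of eps, because phi^+ starts with 1. It has no positive power either,
  by its definition, hence z is a constant beta. At eps = 0 the equation says
  that phi^+(0) d-conjugates u to beta.

  It remains to see that a = 0 ([counterterm_ker]), for then eps b = beta. By
  induction on the degree n, X_i is in ker d for i < n. As ker d is a subalgebra
  stable under delta, a_n and b_n agree with d(X_n) and delta(X_n) up to ker d.
  The coefficient of eps^m in z_n vanishes for m < 0, so d(X_{n,m}) is congruent
  to - delta(X_{n,m-1}) modulo ker d. Starting from the pole of X_n and moving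
  up, X_{n,m-1} in ker d gives d(X_{n,m}) in ker d, and ker d meets d(L) in 0.
  Finally b has coefficients in ker d, and so has beta.

  Everything takes place in the ring of power series (in the degree) whose
  coefficients are Laurent series (in eps) over the enveloping algebra U. To
  return from U to L one needs L_n -> U to be injective; this comes from the
  representations of [der_act]. *)

(** * Algebras, power series and the Euler derivation *)

(** An algebra over k is a ring with a central ring morphism from k. The ring
  may be zero, as is a priori possible for an algebra given by generators and
  relations. *)
HB.mixin Record isAlgebraOver (k : pzRingType) A of GRing.PzRing A := {
  alg_const : k -> A;
  alg_const_zmod_subproof : {morph alg_const : a b / a - b};
  alg_const_monoid_subproof : GRing.monoid_morphism alg_const;
  alg_constC : forall c a, alg_const c * a = a * alg_const c
}.

#[short(type="pzAlgType")]
HB.structure Definition PzAlgebra (k : pzRingType) :=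
  {A of isAlgebraOver k A & GRing.PzRing A}.

HB.instance Definition _ (k : pzRingType) (A : pzAlgType k) :=
  GRing.isZmodMorphism.Build k A alg_const alg_const_zmod_subproof.
HB.instance Definition _ (k : pzRingType) (A : pzAlgType k) :=
  GRing.isMonoidMorphism.Build k A alg_const alg_const_monoid_subproof.

Section PresentedAlgebra.
Variables (k : fieldType) (X : Type) (rel : term k X -> term k X -> Prop).

Let c0 (c : k) : presented rel := pcls rel (Cst c).

Let c0_zmod : {morph c0 : a b / a - b}.
Proof. by move=> a b; rewrite /c0 !pclsC scalerBl. Qed.

Let c0_monoid : GRing.monoid_morphism c0.
Proof.
split=> [|a b]; first by rewrite /c0 pclsC scale1r.
by rewrite /c0 pclsM; apply/pclsP; exact: cong_CstM.
Qed.

HB.instance Definition _ := isAlgebraOver.Build k (presented rel)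
  c0_zmod c0_monoid (@pmulCst k X rel).

Lemma presented_scaleE c (a : presented rel) : c *: a = alg_const c * a.
Proof. by []. Qed.

End PresentedAlgebra.

Lemma sum_triangle (V : nmodType) n (F : nat -> nat -> V) :
  \sum_(i < n.+1) \sum_(j < i.+1) F j (i - j)%N =
  \sum_(j < n.+1) \sum_(l < (n - j).+1) F j l.
Proof.
elim: n => [|n IHn]; first by rewrite !big_ord1.
rewrite big_ord_recr /= IHn [X in _ + X = _]big_ord_recr [RHS]big_ord_recr /=.
rewrite subnn big_ord1 addrA -big_split /=; congr (_ + _).
apply: eq_bigr => j _; rewrite subSn -1?ltnS // [in RHS]big_ord_recr.
by rewrite -subSn -1?ltnS.
Qed.

(** Functions from nat to R, under a name of their own: their product is the
  Cauchy product and not the pointwise one. *)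
Definition pseries (R : Type) : Type := nat -> R.

Section PSeriesRing.
Variables (R : pzRingType).
Implicit Types x y z : nat -> R.

HB.instance Definition _ := GRing.Zmodule.copy (pseries R) (nat -> R).

Lemma conv_mulA : associative (conv (@GRing.mul R)).
Proof.
move=> x y z; apply/funext => n; rewrite /conv.
pose F j l := x j * (y l * z (n - j - l)%N).
under eq_bigr => i _ do rewrite big_distrr /=.
rewrite -(sum_triangle n F); apply: eq_bigr => i _; rewrite big_distrl.
by apply: eq_bigr => j _; rewrite /F mulrA -subnDA subnKC // -ltnS.
Qed.

Lemma conv_mulDl x y z : conv *%R (x + y) z = conv *%R x z + conv *%R y z.
Proof.
apply/funext => n.
transitivity (\sum_(i < n.+1) (x i * z (n - i)%N + y i * z (n - i)%N)).
  by apply: eq_bigr => i _; exact: mulrDl.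
exact: big_split.
Qed.

Lemma conv_mulDr x y z : conv *%R x (y + z) = conv *%R x y + conv *%R x z.
Proof.
apply/funext => n.
transitivity (\sum_(i < n.+1) (x i * y (n - i)%N + x i * z (n - i)%N)).
  by apply: eq_bigr => i _; exact: mulrDr.
exact: big_split.
Qed.

Lemma conv_sub x y n : conv *%R x y n - conv *%R y x n =
  \sum_(i < n.+1) (x i * y (n - i)%N - y (n - i)%N * x i).
Proof.
rewrite /conv [X in _ - X](reindex_inj rev_ord_inj) -sumrB.
by apply: eq_bigr => i _; rewrite /= subSS subKn -1?ltnS.
Qed.

Definition ps1 : pseries R := fun n => (n == 0%N)%:R.

Lemma conv_mul1 : left_id ps1 (conv *%R).
Proof.
move=> x; apply/funext => n; rewrite /conv big_ord_recl subn0 mul1r big1 ?addr0//.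
by move=> i _; rewrite mul0r.
Qed.

Lemma conv_mulr1 : right_id ps1 (conv *%R).
Proof.
move=> x; apply/funext => n; rewrite /conv big_ord_recr /= subnn mulr1 big1 ?add0r//.
by move=> i _; rewrite /ps1 -[_ == _]negbK subn_eq0 -ltnNge ltn_ord mulr0.
Qed.

HB.instance Definition _ := GRing.Zmodule_isPzRing.Build (pseries R)
  conv_mulA conv_mul1 conv_mulr1 conv_mulDl conv_mulDr.

Implicit Types X Y : pseries R.

Lemma psP X Y : (forall n, X n = Y n) -> X = Y.
Proof. by move=> XY; apply/funext. Qed.

Lemma psDE X Y n : (X + Y) n = X n + Y n. Proof. by []. Qed.
Lemma psBE X Y n : (X - Y) n = X n - Y n. Proof. by []. Qed.
Lemma ps1E n : (1 : pseries R) n = (n == 0%N)%:R. Proof. by []. Qed.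
Lemma psME X Y n : (X * Y) n = \sum_(i < n.+1) X i * Y (n - i)%N.
Proof. by []. Qed.

Lemma psMBE X Y n : (X * Y - Y * X) n =
  \sum_(i < n.+1) (X i * Y (n - i)%N - Y (n - i)%N * X i).
Proof. exact: conv_sub. Qed.

Lemma psM0E X Y : (X * Y) 0 = X 0 * Y 0.
Proof. by rewrite psME big_ord1. Qed.

Lemma ps_sumE I (r : seq I) (P : pred I) (F : I -> pseries R) n :
  (\sum_(i <- r | P i) F i) n = \sum_(i <- r | P i) F i n.
Proof. exact: (big_morph (fun X : pseries R => X n)). Qed.

End PSeriesRing.

Section PSeriesConstant.
Variable R : pzRingType.

Definition psC (a : R) : pseries R := fun n => if n == 0%N then a else 0.

Lemma psC_mul a X n : (psC a * X) n = a * X n.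
Proof.
rewrite psME big_ord_recl subn0 /psC eqxx big1 ?addr0 // => i _.
by rewrite mul0r.
Qed.

Lemma psC_mulr a X n : (X * psC a) n = X n * a.
Proof.
rewrite psME big_ord_recr /= subnn /psC eqxx big1 ?add0r // => i _.
by rewrite subn_eq0 leqNgt ltn_ord mulr0.
Qed.

Lemma psC_zmod : {morph psC : a b / a - b}.
Proof. by move=> a b; apply: psP => -[|n]; rewrite psBE /psC ?subr0. Qed.

Lemma psC_monoid : GRing.monoid_morphism psC.
Proof.
split=> [|a b]; apply: psP => n; first by rewrite /psC ps1E; case: (n == _).
by rewrite psC_mul /psC; case: (n == _); rewrite ?mulr0.
Qed.

HB.instance Definition _ := GRing.isZmodMorphism.Build R (pseries R) psC psC_zmod.
HB.instance Definition _ := GRing.isMonoidMorphism.Build R (pseries R) psC psC_monoid.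

End PSeriesConstant.

Section PSeriesAlg.
Variables (k : pzRingType) (R : pzAlgType k).

Let c0 (c : k) : pseries R := psC (alg_const c).

Let c0_zmod : {morph c0 : a b / a - b}.
Proof. by move=> a b; rewrite /c0 !raddfB. Qed.

Let c0_monoid : GRing.monoid_morphism c0.
Proof. by split=> [|a b]; rewrite /c0 ?rmorph1 ?rmorphM. Qed.

Let c0C c X : c0 c * X = X * c0 c.
Proof. by apply: psP => n; rewrite psC_mul psC_mulr alg_constC. Qed.

HB.instance Definition _ := isAlgebraOver.Build k (pseries R)
  c0_zmod c0_monoid c0C.

Lemma ps_constM c (X : pseries R) n : (alg_const c * X) n = alg_const c * X n.
Proof. exact: psC_mul. Qed.

End PSeriesAlg.

Section PSeriesMap.
Variables (R R' : pzRingType) (f : {additive R -> R'}).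

Definition psmap (X : pseries R) : pseries R' := fun n => f (X n).

Lemma psmap_additive : {morph psmap : X Y / X - Y}.
Proof. by move=> X Y; apply: psP => n; rewrite /psmap !psBE raddfB. Qed.

HB.instance Definition _ := GRing.isZmodMorphism.Build (pseries R) (pseries R')
  psmap psmap_additive.

Lemma psmapM : {morph f : a b / a * b} -> {morph psmap : X Y / X * Y}.
Proof.
move=> fM X Y; apply: psP => n; rewrite /psmap !psME raddf_sum.
by apply: eq_bigr => i _; rewrite fM.
Qed.

End PSeriesMap.

Definition leibniz (R : pzRingType) (D : R -> R) :=
  forall a b, D (a * b) = D a * b + a * D b.

Lemma leibniz1 (R : pzRingType) (D : {additive R -> R}) : leibniz D -> D 1 = 0.
Proof.
move=> DM; apply: (addrI (D 1)).
by rewrite addr0 -{3}[1]mul1r DM mul1r mulr1.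
Qed.

Lemma psmap_leibniz (R : pzRingType) (D : {additive R -> R}) :
  leibniz D -> leibniz (psmap D).
Proof.
move=> DM X Y; apply: psP => n; rewrite psDE !psME /psmap raddf_sum -big_split.
by apply: eq_bigr => i _; rewrite DM.
Qed.

Section Euler.
Variable R : pzRingType.

Definition eul (X : pseries R) : pseries R := fun n => X n *+ n.

Lemma eul_additive : {morph eul : X Y / X - Y}.
Proof. by move=> X Y; apply: psP => n; rewrite psBE /eul psBE mulrnBl. Qed.

HB.instance Definition _ := GRing.isZmodMorphism.Build (pseries R) (pseries R)
  eul eul_additive.

Lemma eul_leibniz : leibniz eul.
Proof.
move=> X Y; apply: psP => n; rewrite psDE /eul !psME -sumrMnl -big_split.
apply: eq_bigr => i _ /=; rewrite mulrnAl mulrnAr -mulrnDr.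
by rewrite subnKC // -ltnS.
Qed.

End Euler.

Lemma eul_psmap (R R' : pzRingType) (f : {additive R -> R'}) X :
  eul (psmap f X) = psmap f (eul X).
Proof. by apply: psP => n; rewrite /eul /psmap raddfMn. Qed.

(** Existence for recursions in which the value at n depends on the values at
  the indices below n. *)
Lemma causal_fixpoint (T : Type) (t0 : T) (F : nat -> (nat -> T) -> T) :
  (forall n x y, (forall i, (i < n)%N -> x i = y i) -> F n x = F n y) ->
  exists x, forall n, x n = F n x.
Proof.
move=> Fc; pose Phi x := fun n => F n x; pose it N := iter N Phi (fun=> t0).
have st N M n : (n < N)%N -> (n < M)%N -> it N n = it M n.
  elim: N M n => // N IHN [//|M] n nN nM.
  apply: Fc => i ni; apply: IHN; exact: leq_trans ni _.
exists (fun n => it n.+1 n) => n; rewrite [LHS]/=.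
by apply: Fc => i ni; apply: st.
Qed.

Section Curvature.
Variables (k : fieldType) (char0 : [pchar k] =i pred0) (R : pzAlgType k).
Implicit Types X Y v w phi : pseries R.

Let natr_neq0 n : (n.+1%:R : k) != 0.
Proof. by move/pcharf0P: char0 => ->. Qed.

Lemma mulrSn_eq0 (A : pzAlgType k) (x : A) n : x *+ n.+1 = 0 -> x = 0.
Proof.
move=> xn; rewrite -[x]mul1r -(rmorph1 (@alg_const k A)) -(mulVf (natr_neq0 n)).
by rewrite rmorphM rmorph_nat -mulrA mulr_natl xn mulr0.
Qed.

(** E(X) = X w reads n X_n = (a combination of the X_i with i < n), and n is
  invertible for n > 0. *)
Lemma eul_inj0 X w : eul X = X * w -> w 0 = 0 -> X 0 = 0 -> X = 0.
Proof.
move=> EX w0 X0; apply: psP => n; elim/ltn_ind: n => -[//|n] IHn.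
apply: (@mulrSn_eq0 _ _ n); have := congr1 (fun Y : pseries R => Y n.+1) EX.
rewrite psME big_ord_recr /= subnn w0 mulr0 addr0 big1 //.
by move=> i _; rewrite IHn ?mul0r.
Qed.

Lemma eul_uniq X Y w :
  eul X = X * w -> eul Y = Y * w -> w 0 = 0 -> X 0 = Y 0 -> X = Y.
Proof.
move=> EX EY w0 XY0; apply/eqP; rewrite -subr_eq0; apply/eqP.
apply: (eul_inj0 _ w0); first by rewrite raddfB /= EX EY mulrBl.
by rewrite psBE XY0 subrr.
Qed.

(** The defect R = D(phi) - phi v satisfies E(R) = R w and vanishes in degree
  0, so it is zero. The hypothesis on E(v) is the compatibility of the two
  equations E(phi) = phi w and D(phi) = phi v. *)
Lemma zero_curvature (D : {additive pseries R -> pseries R}) phi v w :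
    leibniz D -> (forall X, eul (D X) = D (eul X)) ->
    eul phi = phi * w -> w 0 = 0 -> eul v = D w + v * w - w * v ->
    D phi 0 = phi 0 * v 0 ->
  D phi = phi * v.
Proof.
move=> DM ED Ephi w0 Ev D0; apply/eqP; rewrite -subr_eq0; apply/eqP.
apply: (eul_inj0 _ w0); last by rewrite psBE psM0E D0 subrr.
rewrite raddfB /= ED Ephi eul_leibniz Ephi Ev DM mulrBl -!mulrA.
rewrite mulrBr [X in _ - X]addrC subrK mulrDr [X in _ - X]addrC opprD addrACA.
by rewrite subrr addr0.
Qed.

End Curvature.

(** * Laurent series *)

Section LaurentZmodule.
Variable V : zmodType.

Definition pole_le (a : nat) (x : int -> V) := forall m, m < - a%:Z -> x m = 0.

Record laurentSeries := Laurent {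
  lcoef :> int -> V;
  lcoef_bounded : exists a, pole_le a lcoef
}.

HB.instance Definition _ := gen_eqMixin laurentSeries.
HB.instance Definition _ := gen_choiceMixin laurentSeries.

Implicit Types x y z : laurentSeries.

Lemma lsP x y : (forall m, x m = y m) -> x = y.
Proof.
case: x y => [x bx] [y by_] /= xy; have {}xy: x = y by apply/funext.
by rewrite -xy in by_ *; rewrite (Prop_irrelevance bx by_).
Qed.

Lemma pole_leW a b (x : int -> V) : (a <= b)%N -> pole_le a x -> pole_le b x.
Proof. by move=> ab xa m mb; apply: xa; lia. Qed.

Lemma lpole2 x y : exists2 a, pole_le a x & pole_le a y.
Proof.
have [a xa] := lcoef_bounded x; have [b yb] := lcoef_bounded y.
exists (maxn a b); [apply: pole_leW xa|apply: pole_leW yb]; lia.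
Qed.

Fact ls0_bounded : exists a, pole_le a (fun=> 0). Proof. by exists 0%N. Qed.
Definition ls0 := Laurent ls0_bounded.

Fact lsN_bounded x : exists a, pole_le a (fun m => - x m).
Proof.
by have [a xa] := lcoef_bounded x; exists a => m ma; rewrite xa ?oppr0.
Qed.
Definition lsN x := Laurent (lsN_bounded x).

Fact lsD_bounded x y : exists a, pole_le a (fun m => x m + y m).
Proof.
by have [a xa ya] := lpole2 x y; exists a => m ma; rewrite xa ?ya ?addr0.
Qed.
Definition lsD x y := Laurent (lsD_bounded x y).

Fact lsDA : associative lsD.
Proof. by move=> x y z; apply: lsP => m; rewrite /= addrA. Qed.
Fact lsDC : commutative lsD.
Proof. by move=> x y; apply: lsP => m; rewrite /= addrC. Qed.
Fact ls0D : left_id ls0 lsD.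
Proof. by move=> x; apply: lsP => m; rewrite /= add0r. Qed.
Fact lsND : left_inverse ls0 lsN lsD.
Proof. by move=> x; apply: lsP => m; rewrite /= addNr. Qed.

HB.instance Definition _ :=
  GRing.isZmodule.Build laurentSeries lsDA lsDC ls0D lsND.

Lemma lsDE x y m : (x + y) m = x m + y m. Proof. by []. Qed.
Lemma lsBE x y m : (x - y) m = x m - y m. Proof. by []. Qed.

Lemma ls_sumE I (r : seq I) (P : pred I) (F : I -> laurentSeries) m :
  (\sum_(i <- r | P i) F i) m = \sum_(i <- r | P i) F i m.
Proof. exact: (big_morph (fun x : laurentSeries => x m)). Qed.

Lemma lsMnE x n m : (x *+ n) m = x m *+ n.
Proof. by elim: n => // n IHn; rewrite !mulrS lsDE IHn. Qed.

(** The power series eps ^ a x. Identities between Laurent series are reduced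
  through it to identities between power series, once a bounds the order of
  the poles of both sides. *)
Definition strip (a : nat) (x : int -> V) : pseries V := fun i => x (i%:Z - a%:Z).

Lemma strip_inj a x y : pole_le a x -> pole_le a y ->
  strip a x = strip a y -> x = y.
Proof.
move=> xa ya xy; apply: lsP => m; have [ma|am] := ltP m (- a%:Z).
  by rewrite xa ?ya.
have -> : m = (absz (m + a%:Z))%:Z - a%:Z by lia.
exact: (congr1 (fun X => X (absz (m + a%:Z))) xy).
Qed.

Lemma pole_leD a x y : pole_le a x -> pole_le a y -> pole_le a (x + y).
Proof. by move=> xa ya m ma; rewrite lsDE xa ?ya ?addr0. Qed.

End LaurentZmodule.

Section LaurentRing.
Variable R : pzRingType.
Implicit Types x y z : laurentSeries R.

Definition lconv (x y : int -> R) (m : int) : R :=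
  \sum_(p \in [set: int]) x p * y (m - p).

(** The sum over all integers that defines the product is, in each degree, a
  Cauchy sum of the stripped series. *)
Lemma lconvE a b (x y : int -> R) n : pole_le a x -> pole_le b y ->
  lconv x y (n%:Z - (a + b)%N%:Z) = conv *%R (strip a x) (strip b y) n.
Proof.
move=> xa yb; rewrite /lconv /conv.
pose r : seq int := [seq i%:Z - a%:Z | i <- iota 0 n.+1].
have r_uniq : uniq r by rewrite map_inj_uniq ?iota_uniq // => i j; lia.
rewrite (fsbigE r) //=; last first.
  move=> p _ /negP pr; have [pa|ap] := ltP p (- a%:Z).
    by rewrite xa ?mul0r.
  have [pn|np] := leP p (n%:Z - a%:Z).
    exfalso; apply: pr; apply/mapP; exists (absz (p + a%:Z)); last by lia.
    by rewrite mem_iota; lia.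
  by rewrite yb ?mulr0//; lia.
rewrite (eq_bigl xpredT) => [|p]; last by rewrite in_setT.
rewrite big_map -[iota 0 n.+1]/(index_iota 0 n.+1) big_mkord.
apply: eq_bigr => i _; rewrite /strip; congr (_ * y _).
by have := ltn_ord i; lia.
Qed.

Lemma lconv_pole a b (x y : int -> R) :
  pole_le a x -> pole_le b y -> pole_le (a + b) (lconv x y).
Proof.
move=> xa yb m mab; apply: fsbig1 => p _; have [pa|ap] := ltP p (- a%:Z).
  by rewrite xa ?mul0r.
by rewrite yb ?mulr0//; lia.
Qed.

Fact lsM_bounded x y : exists a, pole_le a (lconv x y).
Proof.
have [a xa] := lcoef_bounded x; have [b yb] := lcoef_bounded y.
by exists (a + b)%N; exact: lconv_pole.
Qed.
Definition lsM x y := Laurent (lsM_bounded x y).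

Fact ls1_bounded : exists a, pole_le a (fun m => (m == 0)%:R : R).
Proof. by exists 0%N => m m0; case: eqP => // e; rewrite e in m0. Qed.
Definition ls1 := Laurent ls1_bounded.

Lemma stripM a b x y : pole_le a x -> pole_le b y ->
  strip (a + b) (lsM x y) = strip a x * strip b y :> pseries R.
Proof. by move=> xa yb; apply: psP => n; exact: lconvE. Qed.

Lemma strip1 : strip 0 ls1 = 1.
Proof. by apply: psP => n; rewrite ps1E /strip /= subr0. Qed.

Lemma pole_ls1 : pole_le 0 ls1.
Proof. by move=> m m0; rewrite /=; case: eqP => // e; rewrite e in m0. Qed.

Fact lsMA : associative lsM.
Proof.
move=> x y z; have [a xa] := lcoef_bounded x.
have [b yb] := lcoef_bounded y; have [c zc] := lcoef_bounded z.
have yz := lconv_pole yb zc; have xy := lconv_pole xa yb.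
apply: (@strip_inj _ (a + (b + c))%N); first exact: lconv_pole.
  by rewrite addnA; exact: lconv_pole.
by rewrite stripM // stripM // addnA stripM // stripM // mulrA.
Qed.

Fact lsM1 : left_id ls1 lsM.
Proof.
move=> x; have [a xa] := lcoef_bounded x; apply: (@strip_inj _ (0 + a)%N) => //.
  by apply: lconv_pole => //; exact: pole_ls1.
by rewrite stripM //; [rewrite strip1 mul1r|exact: pole_ls1].
Qed.

Fact lsMr1 : right_id ls1 lsM.
Proof.
move=> x; have [a xa] := lcoef_bounded x; apply: (@strip_inj _ (a + 0)%N) => //.
- by apply: lconv_pole => //; exact: pole_ls1.
- by rewrite addn0.
by rewrite stripM //; [rewrite strip1 mulr1 addn0|exact: pole_ls1].
Qed.

Fact lsMDl : left_distributive lsM +%R.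
Proof.
move=> x y z; have [a xa ya] := lpole2 x y; have [b zb] := lcoef_bounded z.
have xya := pole_leD xa ya.
apply: (@strip_inj _ (a + b)%N); first exact: lconv_pole.
  by apply: pole_leD; exact: lconv_pole.
have -> : strip (a + b) (lsM x z + lsM y z) =
  strip (a + b) (lsM x z) + strip (a + b) (lsM y z) :> pseries R by [].
by rewrite !stripM // -mulrDl.
Qed.

Fact lsMDr : right_distributive lsM +%R.
Proof.
move=> z x y; have [a xa ya] := lpole2 x y; have [b zb] := lcoef_bounded z.
have xya := pole_leD xa ya.
apply: (@strip_inj _ (b + a)%N); first exact: lconv_pole.
  by apply: pole_leD; exact: lconv_pole.
have -> : strip (b + a) (lsM z x + lsM z y) =
  strip (b + a) (lsM z x) + strip (b + a) (lsM z y) :> pseries R by [].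
by rewrite !stripM // -mulrDr.
Qed.

HB.instance Definition _ := GRing.Zmodule_isPzRing.Build (laurentSeries R)
  lsMA lsM1 lsMr1 lsMDl lsMDr.

Lemma ls1E m : (1 : laurentSeries R) m = (m == 0)%:R. Proof. by []. Qed.
Lemma lsME x y m : (x * y) m = \sum_(p \in [set: int]) x p * y (m - p).
Proof. by []. Qed.

Lemma pole_leM a b x y : pole_le a x -> pole_le b y -> pole_le (a + b) (x * y).
Proof. exact: lconv_pole. Qed.

Lemma strip_mul a b x y : pole_le a x -> pole_le b y ->
  strip (a + b) (x * y) = strip a x * strip b y :> pseries R.
Proof. exact: stripM. Qed.

Lemma lsM_coef0 x y : pole_le 0 x -> pole_le 0 y -> (x * y) 0 = x 0 * y 0.
Proof.
move=> x0 y0; have := congr1 (fun X : pseries R => X 0%N) (strip_mul x0 y0).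
by rewrite psM0E.
Qed.

Lemma lsM_ind (F : set R) x y : F 0 ->
  (forall a b, F a -> F b -> F (a + b)) -> (forall i j, F (x i * y j)) ->
  forall m, F ((x * y) m).
Proof.
move=> F0 FD Fxy m; rewrite lsME; apply: (big_ind F) => //.
Qed.

(** The terms of x y and of y x are paired off, so that this also serves for
  families that are closed under commutators but not under products. *)
Lemma lsMB_ind (F : set R) x y : F 0 ->
  (forall a b, F a -> F b -> F (a + b)) ->
  (forall i j, F (x i * y j - y j * x i)) ->
  forall m, F ((x * y - y * x) m).
Proof.
move=> F0 FD Fxy m; have [a xa] := lcoef_bounded x.
have [b yb] := lcoef_bounded y.
have [mab|abm] := ltP m (- (a + b)%N%:Z).
  by rewrite lsBE (pole_leM xa yb) // (pole_leM yb xa) ?subr0 // addnC.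
have -> : m = (absz (m + (a + b)%N%:Z))%:Z - (a + b)%N%:Z by lia.
set n := absz _; rewrite lsBE.
have -> : (x * y) (n%:Z - (a + b)%N%:Z) = (strip a x * strip b y : pseries R) n.
  by rewrite -strip_mul.
have -> : (y * x) (n%:Z - (a + b)%N%:Z) = (strip b y * strip a x : pseries R) n.
  by rewrite -strip_mul // addnC.
rewrite -psBE psMBE; apply: (big_ind F) => // i _; exact: Fxy.
Qed.

End LaurentRing.

Section LaurentMap.
Variables (V V' : zmodType) (f : {additive V -> V'}).

Fact lsmap_bounded (x : laurentSeries V) : exists a, pole_le a (fun m => f (x m)).
Proof.
by have [a xa] := lcoef_bounded x; exists a => m ma; rewrite xa ?raddf0.
Qed.
Definition lsmap x := Laurent (lsmap_bounded x).

Lemma lsmap_additive : {morph lsmap : x y / x - y}.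
Proof. by move=> x y; apply: lsP => m; rewrite /= !raddfB. Qed.

HB.instance Definition _ :=
  GRing.isZmodMorphism.Build (laurentSeries V) (laurentSeries V')
    lsmap lsmap_additive.

Lemma lsmapE x m : lsmap x m = f (x m). Proof. by []. Qed.

Lemma pole_lsmap a (x : laurentSeries V) : pole_le a x -> pole_le a (lsmap x).
Proof. by move=> xa m ma; rewrite lsmapE xa ?raddf0. Qed.

End LaurentMap.

Lemma lsmapM (R R' : pzRingType) (f : {additive R -> R'}) :
  {morph f : a b / a * b} -> {morph lsmap f : x y / x * y}.
Proof.
move=> fM x y; have [a xa] := lcoef_bounded x; have [b yb] := lcoef_bounded y.
have xa' := pole_lsmap f xa; have yb' := pole_lsmap f yb.
apply: (@strip_inj _ (a + b)%N); last 1 first.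
- rewrite strip_mul // -[LHS]/(psmap f (strip (a + b) (x * y))) strip_mul //.
  exact: psmapM.
- exact/pole_lsmap/pole_leM.
- exact: pole_leM.
Qed.

Lemma lsmap_leibniz (R : pzRingType) (D : {additive R -> R}) :
  leibniz D -> leibniz (lsmap D).
Proof.
move=> DM x y; have [a xa] := lcoef_bounded x; have [b yb] := lcoef_bounded y.
have xa' := pole_lsmap D xa; have yb' := pole_lsmap D yb.
apply: (@strip_inj _ (a + b)%N); last 1 first.
- rewrite -[LHS]/(psmap D (strip (a + b) (x * y))) strip_mul //.
  rewrite -[RHS]/(strip (a + b) (lsmap D x * y) +
                  strip (a + b) (x * lsmap D y) : pseries R).
  by rewrite !strip_mul //; exact: (psmap_leibniz DM (strip a x) (strip b y)).
- exact/pole_lsmap/pole_leM.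
- by apply: pole_leD; exact: pole_leM.
Qed.

Section Monomial.
Variable R : pzRingType.

Fact lmono_bounded (j : int) (c : R) :
  exists a, pole_le a (fun m => if m == j then c else 0).
Proof. by exists (absz j) => m mj; case: eqP => // e; lia. Qed.
Definition lmono j c := Laurent (lmono_bounded j c).

Lemma lmonoE j c m : lmono j c m = if m == j then c else 0. Proof. by []. Qed.

Lemma lmono_mul j c (x : laurentSeries R) m : (lmono j c * x) m = c * x (m - j).
Proof.
rewrite lsME (fsbigE [:: j]) //; last first.
  by move=> p _; rewrite lmonoE inE; case: eqP => // _ _; rewrite mul0r.
by rewrite big_mkcond big_seq1 in_setT lmonoE eqxx.
Qed.

Lemma lmono_mulr j c (x : laurentSeries R) m : (x * lmono j c) m = x (m - j) * c.
Proof.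
rewrite lsME (fsbigE [:: m - j]) //; last first.
  by move=> p _; rewrite lmonoE inE => pm; case: eqP => [e|_]; rewrite ?mulr0//; lia.
by rewrite big_mkcond big_seq1 in_setT lmonoE subKr eqxx.
Qed.

Lemma lmono_zmod j : {morph lmono j : a b / a - b}.
Proof.
by move=> a b; apply: lsP => m; rewrite lsBE !lmonoE; case: eqP; rewrite ?subr0.
Qed.

HB.instance Definition _ j :=
  GRing.isZmodMorphism.Build R (laurentSeries R) (lmono j) (lmono_zmod j).

End Monomial.

Section LaurentAlg.
Variables (k : pzRingType) (R : pzAlgType k).

Let c0 (c : k) : laurentSeries R := lmono 0 (alg_const c : R).

Let c0_zmod : {morph c0 : a b / a - b}.
Proof. by move=> a b; rewrite /c0 !raddfB. Qed.

Let c0_monoid : GRing.monoid_morphism c0.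
Proof.
split=> [|a b]; apply: lsP => m; rewrite ?lmono_mul /c0 ?rmorph1 ?rmorphM.
  by rewrite lmonoE ls1E; case: eqP.
by rewrite !lmonoE subr0; case: eqP; rewrite ?mulr0.
Qed.

Let c0C c x : c0 c * x = x * c0 c.
Proof. by apply: lsP => m; rewrite lmono_mul lmono_mulr alg_constC. Qed.

HB.instance Definition _ := isAlgebraOver.Build k (laurentSeries R)
  c0_zmod c0_monoid c0C.

Lemma ls_constM c (x : laurentSeries R) m : (alg_const c * x) m = alg_const c * x m.
Proof. by rewrite [LHS]lmono_mul subr0. Qed.

End LaurentAlg.

(** * The logarithmic derivative of an exponential *)

Section FormalSums.
Variable R : pzRingType.
Implicit Types f g : pseries (pseries R).

(** Summability of a series of power series: each component receives finitely
  many nonzero contributions. *)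
Definition small f := forall r i, (i < r)%N -> f r i = 0.

Definition fsum f : pseries R := fun n => \sum_(r < n.+1) f r n.

Lemma fsum_widen f n N : small f -> (n <= N)%N ->
  fsum f n = \sum_(r < N.+1) f r n.
Proof.
move=> sf nN; rewrite /fsum (big_ord_widen N.+1 (fun r => f r n)) //.
rewrite big_mkcond; apply: eq_bigr => r _; case: ifPn => // nr.
by rewrite sf // ltnNge -ltnS.
Qed.

Lemma small_mul_eq0 f g r s i : small f -> small g -> (i < r + s)%N ->
  (f r * g s) i = 0.
Proof.
move=> sf sg irs; rewrite psME big1 // => j _.
have [jr|rj] := ltnP j r; first by rewrite sf ?mul0r.
by rewrite sg ?mulr0 //; have := ltn_ord j; lia.
Qed.

Lemma fsumM f g : small f -> small g -> fsum f * fsum g = fsum (f * g).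
Proof.
move=> sf sg; apply: psP => n.
pose F r s := (f r * g s) n.
transitivity (\sum_(r < n.+1) \sum_(s < n.+1) F r s).
  transitivity (((\sum_(r < n.+1) f r) * (\sum_(s < n.+1) g s)) n).
    rewrite !psME; apply: eq_bigr => i _; rewrite !ps_sumE.
    by rewrite !(@fsum_widen _ _ n) // ?leq_subr // -ltnS.
  rewrite big_distrl /= ps_sumE; apply: eq_bigr => r _.
  by rewrite big_distrr /= ps_sumE.
transitivity (\sum_(r < n.+1) \sum_(s < (n - r).+1) F r s); last first.
  rewrite -sum_triangle; apply: eq_bigr => q _.
  by rewrite [RHS]ps_sumE.
apply: eq_bigr => r _.
rewrite [RHS](big_ord_widen n.+1 (fun s => F r s)); last by lia.
rewrite [RHS]big_mkcond; apply: eq_bigr => s _; case: ifPn => // ns.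
by rewrite /F small_mul_eq0 //; lia.
Qed.

End FormalSums.

Section Exponential.
Variables (k : fieldType) (char0 : [pchar k] =i pred0) (R : pzAlgType k).
Implicit Types X Y : pseries R.

Definition pexp X : pseries R :=
  fun n => \sum_(r < n.+1) (alg_const (r`!%:R : k)^-1 * X ^+ r) n.

Fixpoint logder_term X Y r : pseries R :=
  if r is s.+1 then
    alg_const (r.+1%:R : k)^-1 *
      (logder_term X Y s * X - X * logder_term X Y s)
  else Y.

(** For Y = D(X), this is (1 - exp(- ad X)) / (ad X) applied to D(X), which is
  exp(- X) D(exp(X)); the r-th term is (- ad X)^r (Y) / (r + 1)!. In degree n
  the terms with r >= n vanish when X and Y have no component of degree 0. *)
Definition logder X Y : pseries R := fun n => \sum_(r < n) logder_term X Y r n.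

Let natr_neq0 n : (n.+1%:R : k) != 0.
Proof. by move/pcharf0P: char0 => ->. Qed.

Lemma alg_const_nat (A : pzAlgType k) n (x : A) :
  alg_const (n.+1%:R : k)^-1 * x *+ n.+1 = x.
Proof.
rewrite -mulr_natl mulrA -(rmorph_nat (@alg_const k A)) -rmorphM.
by rewrite mulfV ?natr_neq0 // rmorph1 mul1r.
Qed.

Lemma small_exp X : X 0 = 0 -> small (fun r => X ^+ r : pseries R).
Proof.
move=> X0; elim=> // r IHr i ir; rewrite exprS psME big1 // => j _.
case: j => -[|j] ji /=; first by rewrite X0 mul0r.
by rewrite IHr ?mulr0 //; lia.
Qed.

Let tX X : pseries (pseries R) := fun r => if r == 1%N then X else 0.

Let tX_mul X (Z : pseries (pseries R)) r : (tX X * Z) r.+1 = X * Z r.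
Proof.
rewrite psME !big_ord_recl big1 ?addr0 => [|i _]; rewrite /tX /= ?mul0r //.
by rewrite add0r /bump /= subSS subn0.
Qed.

Let tX_mulr X (Z : pseries (pseries R)) r : (Z * tX X) r.+1 = Z r * X.
Proof.
rewrite psME !big_ord_recr big1 ?add0r => [|i _] /=; rewrite /tX.
  by rewrite subSnn subnn /= mulr0 addr0 add0r.
by case: eqP; rewrite ?mulr0 // => e; have := ltn_ord i; lia.
Qed.

Let tX0 X : tX X 0 = 0. Proof. by []. Qed.

Variable D : {additive pseries R -> pseries R}.
Hypothesis D_leibniz : leibniz D.
Hypothesis D_local : forall X Y n, X n = Y n -> D X n = D Y n.

(** With a formal parameter t, exp(t X) satisfies t d/dt exp(t X) =
  exp(t X) (t X), where t d/dt is the Euler derivation of power series in t.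
  The recursion that defines the terms v of [logder] is the zero-curvature
  relation for this equation. The lemma is its conclusion D(exp(t X)) =
  exp(t X) v(t), summed at t = 1. *)
Lemma pexp_logder X : X 0 = 0 -> D X 0 = 0 ->
  D (pexp X) = pexp X * logder X (D X).
Proof.
move=> X0 DX0.
(* psi = exp(t X), and v r.+1 is the r-th term of [logder] *)
pose psi : pseries (pseries R) := fun r => alg_const (r`!%:R : k)^-1 * X ^+ r.
pose v : pseries (pseries R) :=
  fun r => if r is s.+1 then logder_term X (D X) s else 0.
have small_psi : small psi.
  by move=> r i ir; rewrite /psi ps_constM small_exp ?mulr0.
have small_v : small v.
  case=> // r; elim: r => [|r IHr] i ir; first by case: i ir.
  rewrite [v _]/= ps_constM psBE !psME !big1 ?subr0 ?mulr0 //.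
    move=> j _; case: j => -[|j] ji /=; first by rewrite X0 mul0r.
    by rewrite [logder_term _ _ _ _]IHr ?mulr0 //; lia.
  move=> j _; case: (eqVneq (j : nat) i) => [->|ji].
    by rewrite subnn X0 mulr0.
  by rewrite [logder_term _ _ _ _]IHr ?mul0r //; have := ltn_ord j; lia.
have -> : pexp X = fsum psi by [].
have -> : logder X (D X) = fsum v.
  by apply: psP => n; rewrite /fsum big_ord_recl add0r.
rewrite fsumM //.
have <- : psmap D psi = psi * v.
  apply: (@zero_curvature _ char0 _ _ _ _ (tX X)).
  - exact: psmap_leibniz.
  - by move=> Z; exact: eul_psmap.
  - apply: psP => -[|r]; first by rewrite psM0E mulr0.
    have psiS : psi r.+1 = alg_const (r.+1%:R : k)^-1 * (psi r * X).
      by rewrite /psi factS natrM invfM rmorphM exprSr !mulrA.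
    by rewrite tX_mulr /eul psiS alg_const_nat.
  - by [].
  - apply: psP => -[|r].
      rewrite psBE psDE !psM0E tX0 ?mul0r ?mulr0 subr0 addr0; symmetry.
      exact: (raddf0 D).
    rewrite psBE psDE tX_mul tX_mulr /psmap /eul.
    case: r => [|r] /=; first by rewrite mul0r mulr0 subr0 addr0.
    by rewrite [psmap D _ _](raddf0 D) add0r alg_const_nat.
  - have psi0 : psi 0 = 1 by rewrite /psi expr0 mulr1 fact0 invr1 rmorph1.
    by rewrite mulr0 -[LHS]/(D (psi 0)) psi0 (leibniz1 D_leibniz).
apply: psP => n; rewrite /fsum.
transitivity (D (\sum_(r < n.+1) psi r) n); first by apply: D_local; rewrite ps_sumE.
by rewrite raddf_sum ps_sumE.
Qed.

End Exponential.

(** ** Families of subspaces closed under commutators *)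

Section LieFamily.
Variables (k : fieldType) (R : pzAlgType k).

Record lie_family (P : nat -> set R) : Prop := LieFamily {
  lie_family0 : forall n, P n 0;
  lie_familyD : forall n a b, P n a -> P n b -> P n (a + b);
  lie_familyZ : forall n c a, P n a -> P n (alg_const c * a);
  lie_familyB : forall i j a b, P i a -> P j b -> P (i + j)%N (a * b - b * a)
}.

Variable P : nat -> set R.
Hypothesis Plie : lie_family P.

Lemma lie_family_sum n I (r : seq I) (F : I -> R) :
  (forall i, P n (F i)) -> P n (\sum_(i <- r) F i).
Proof.
move=> PF; apply: (big_ind (P n)) => //; first exact: lie_family0.
exact: lie_familyD.
Qed.

Lemma lie_family_muln n a m : P n a -> P n (a *+ m).
Proof.
move=> Pa; elim: m => [|m IHm]; first exact: lie_family0.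
by rewrite mulrS; exact: lie_familyD.
Qed.

Lemma lie_familyN n a : P n a -> P n (- a).
Proof.
by rewrite -[- a]mulN1r -(rmorph1 (@alg_const k R)) -rmorphN; exact: lie_familyZ.
Qed.

(** Without components of degree 0, a commutator involves in degree n only the
  components of its arguments in degrees below n. *)
Lemma lie_family_comm (X Y : pseries R) n : X 0 = 0 -> Y 0 = 0 ->
  (forall i, (i < n)%N -> P i (X i)) -> (forall i, (i < n)%N -> P i (Y i)) ->
  P n ((X * Y - Y * X) n).
Proof.
move=> X0 Y0 PX PY; rewrite psMBE; apply: lie_family_sum => i.
have [i0|i0] := posnP i; first by rewrite i0 X0 mul0r mulr0 subrr; exact: lie_family0.
case: (eqVneq (i : nat) n) => [->|ni].
  by rewrite subnn Y0 mul0r mulr0 subrr; exact: lie_family0.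
have /ltnSE := ltn_ord i; rewrite leq_eqVlt (negbTE ni) /= => lin.
rewrite -[in X in P X](subnKC (ltnW lin)).
by apply: (lie_familyB Plie); [exact: PX|apply: PY; lia].
Qed.

Lemma logder_term0 (X Y : pseries R) r : X 0 = 0 -> Y 0 = 0 -> logder_term X Y r 0 = 0.
Proof.
move=> X0 Y0; case: r => //= r.
by rewrite ps_constM psBE !psM0E X0 mul0r mulr0 subrr mulr0.
Qed.

Lemma logder_term_family (X Y : pseries R) n : X 0 = 0 -> Y 0 = 0 ->
  (forall i, (i < n)%N -> P i (X i)) -> (forall i, (i < n)%N -> P i (Y i)) ->
  forall r, (forall i, (i < n)%N -> P i (logder_term X Y r i)) /\
            P n (logder_term X Y r.+1 n).
Proof.
move=> X0 Y0 PX PY; elim=> [|r [IHlt IHn]].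
  split=> //=; rewrite ps_constM; apply: (lie_familyZ Plie).
  exact: lie_family_comm.
have step m : (m <= n)%N -> P m (logder_term X Y r.+1 m).
  move=> mn; rewrite /= ps_constM; apply: (lie_familyZ Plie).
  apply: lie_family_comm => //; first exact: logder_term0.
    by move=> i im; apply: IHlt; exact: leq_trans im mn.
  by move=> i im; apply: PX; exact: leq_trans im mn.
split=> [i lin|]; first by apply: step; exact: ltnW.
rewrite [logder_term _ _ _]/= -/(logder_term X Y r.+1).
rewrite ps_constM; apply: (lie_familyZ Plie).
apply: lie_family_comm => //; first exact: (@logder_term0 X Y r.+1).
by move=> i lin; apply: step; exact: ltnW.
Qed.

(** In degree n, [logder X Y] is Y_n plus brackets of components of lower
  degree. The membership of Y_n itself is not assumed, which is what inductions
  on the degree need. *)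
Lemma logder_tail_family (X Y : pseries R) n : X 0 = 0 -> Y 0 = 0 ->
  (forall i, (i < n)%N -> P i (X i)) -> (forall i, (i < n)%N -> P i (Y i)) ->
  P n ((logder X Y - Y) n).
Proof.
move=> X0 Y0 PX PY; rewrite psBE /logder; case: n PX PY => [|n] PX PY.
  by rewrite big_ord0 Y0 subr0; exact: lie_family0.
rewrite big_ord_recl addrC addKr; apply: lie_family_sum => r.
by have [] := logder_term_family X0 Y0 PX PY r.
Qed.

Lemma logder_family (X Y : pseries R) : X 0 = 0 -> Y 0 = 0 ->
  (forall i, P i (X i)) -> (forall i, P i (Y i)) ->
  forall n, P n (logder X Y n).
Proof.
move=> X0 Y0 PX PY n; rewrite -[logder X Y n](subrK (Y n)).
by apply: (lie_familyD Plie) => //; apply: logder_tail_family.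
Qed.

End LieFamily.

(** * Graded Lie algebras and their enveloping algebras *)

Local Notation iota := Defs.iota.

Section GradedLie.
Variables (k : fieldType) (L : graded_lie k).
Implicit Types x y z : L.

Lemma lie_comp_0 n : lie_comp n (0 : L).
Proof.
have [s sP] := lie_comp_fin L n; apply/sP; exists (fun=> 0).
by rewrite big1 // => i _; rewrite scale0r.
Qed.

Lemma lie_compP n c x y : lie_comp n x -> lie_comp n y -> lie_comp n (c *: x + y).
Proof.
have [s sP] := lie_comp_fin L n => /sP [a ->] /sP [b ->]; apply/sP.
exists (fun i => c * a i + b i); rewrite scaler_sumr -big_split.
by apply: eq_bigr => i _; rewrite scalerDl scalerA.
Qed.

Lemma lie_compD n x y : lie_comp n x -> lie_comp n y -> lie_comp n (x + y).
Proof. by move=> xn yn; rewrite -[x]scale1r; exact: lie_compP. Qed.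

Lemma lie_compZ n c x : lie_comp n x -> lie_comp n (c *: x).
Proof. by move=> xn; rewrite -[_ *: _]addr0; apply: lie_compP xn (lie_comp_0 n). Qed.

Lemma lie_compB n x y : lie_comp n x -> lie_comp n y -> lie_comp n (x - y).
Proof. by move=> xn yn; rewrite addrC -scaleN1r; exact: lie_compP. Qed.

Lemma lie_brDl x y z : lie_br (x + y) z = lie_br x z + lie_br y z.
Proof. by have := lie_brl 1 x y z; rewrite !scale1r. Qed.

Lemma lie_brDr x y z : lie_br x (y + z) = lie_br x y + lie_br x z.
Proof. by have := lie_brr 1 x y z; rewrite !scale1r. Qed.

Lemma lie_br0l z : lie_br (0 : L) z = 0.
Proof. by apply: (addrI (lie_br 0 z)); rewrite -lie_brDl !addr0. Qed.

Lemma lie_br0r z : lie_br z (0 : L) = 0.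
Proof. by apply: (addrI (lie_br z 0)); rewrite -lie_brDr !addr0. Qed.

Lemma lie_brZl c x z : lie_br (c *: x) z = c *: lie_br x z.
Proof. by have := lie_brl c x 0 z; rewrite lie_br0l !addr0. Qed.

Lemma lie_brZr c x z : lie_br x (c *: z) = c *: lie_br x z.
Proof. by have := lie_brr c x z 0; rewrite lie_br0r !addr0. Qed.

Lemma lie_brBr x y z : lie_br x (y - z) = lie_br x y - lie_br x z.
Proof. by rewrite lie_brDr -scaleN1r lie_brZr scaleN1r. Qed.

Lemma lie_brC x y : lie_br x y = - lie_br y x.
Proof.
apply/eqP; rewrite -addr_eq0; apply/eqP; have := lie_brxx (x + y).
by rewrite lie_brDl !lie_brDr !lie_brxx add0r addr0.
Qed.

Lemma lie_br_br x y z :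
  lie_br (lie_br x y) z = lie_br x (lie_br y z) - lie_br y (lie_br x z).
Proof.
have /eqP := lie_jacobi x y z; rewrite addr_eq0 => /eqP e.
rewrite lie_brC -e; congr (_ + _).
by rewrite [lie_br z x]lie_brC -[- _]scaleN1r lie_brZr scaleN1r.
Qed.

Section DerivationRep.
Variable d : derivation L.

(** The semidirect product of L by k d acts on itself by the adjoint
  representation, in which x in L sends (y, s) to ([x, y] - s d(x), 0). As a
  representation of L it extends to U, and it shows that d(x) depends only on
  the image of x in U. *)
Fixpoint der_act (t : term k L) (v : L * k^o) : L * k^o :=
  match t with
  | Gen x => (lie_br x v.1 - v.2 *: d x, 0)
  | Cst c => c *: v
  | Add s t => der_act s v + der_act t v
  | Mul s t => der_act s (der_act t v)
  end.

Lemma der_act_linear t c v w :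
  der_act t (c *: v + w) = c *: der_act t v + der_act t w.
Proof.
elim: t v w => [x|a|s IHs t IHt|s IHs t IHt] v w /=.
- apply: injective_projections => /=; last by rewrite scaler0 addr0.
  rewrite lie_brr scalerBr addrACA -opprD; congr (_ - _).
  by rewrite scalerDl scalerA.
- by rewrite scalerDr !scalerA mulrC.
- by rewrite IHs IHt scalerDr addrACA.
- by rewrite IHt IHs.
Qed.

Lemma der_actD t v w : der_act t (v + w) = der_act t v + der_act t w.
Proof. by have := der_act_linear t 1 v w; rewrite !scale1r. Qed.

Lemma der_act0 t : der_act t 0 = 0.
Proof. by apply: (addrI (der_act t 0)); rewrite -der_actD !addr0. Qed.

Lemma der_actZ t c v : der_act t (c *: v) = c *: der_act t v.
Proof. by have := der_act_linear t c v 0; rewrite der_act0 !addr0. Qed.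

Lemma der_act_cong s t : cong (@urel k L) s t -> der_act s =1 der_act t.
Proof.
elim=> //=.
- move=> _ _ [x y|c x|x y] v; apply: injective_projections => /=;
    rewrite ?addr0 ?scaler0 //=.
  + by rewrite lie_brDl linearD scalerDr opprD addrACA.
  + have dZ : d (c *: x) = c *: d x by exact: linearZ.
    by rewrite lie_brZl dZ scalerBr !scalerA (mulrC c).
  + rewrite !scale0r !subr0 !lie_brBr lie_br_br der_br scalerDr.
    rewrite [lie_br (d x) y]lie_brC scalerN !lie_brZr opprD opprK.
    by rewrite [X in _ + X + _]addrC addrACA subrK addrK.
- by move=> {}s {}t _ H v; rewrite H.
- by move=> {}s {}t r _ H1 _ H2 v; rewrite H1 H2.
- by move=> s1 s2 t1 t2 _ H1 _ H2 v; rewrite H1 H2.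
- by move=> s1 s2 t1 t2 _ H1 _ H2 v; rewrite H1 H2.
- by move=> s1 s2 t1 v; rewrite addrA.
- by move=> s1 s2 v; rewrite addrC.
- by move=> s1 v; rewrite scale0r add0r.
- by move=> s1 v; rewrite scaleN1r addNr scale0r.
- by move=> s1 v; rewrite scale1r.
- by move=> s1 s2 t1 v; rewrite der_actD.
- by move=> a b v; rewrite scalerDl.
- by move=> a b v; rewrite scalerA.
- by move=> a s1 v; rewrite der_actZ.
Qed.

(** Apply the image of x in U to the vector (0, 1). *)
Lemma iota_eq0_der x : iota x = 0 -> d x = 0.
Proof.
move=> /pclsP /der_act_cong /(_ (0, 1)) /= /(congr1 fst) /=.
by rewrite lie_br0r scale1r scale0r sub0r => /eqP; rewrite oppr_eq0 => /eqP.
Qed.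

End DerivationRep.
End GradedLie.

(** * Lie elements of the enveloping algebra *)

Section EnvelopingMaps.
Variables (k : fieldType) (L : graded_lie k).

Notation U := (presented (@urel k L)).
Notation UU := (presented (@trel k L)).

HB.instance Definition _ (d : derivation L) :=
  GRing.isLinear.Build k U U _ (uder d) (uder_linear d).
HB.instance Definition _ :=
  GRing.isLinear.Build k U UU _ (@coprod k L) (@coprod_linear k L).

HB.instance Definition _ := GRing.isLinear.Build k L U _ (@iota k L) (@iotaP k L).

Definition tensl (a : U) : UU := tens a 1.
Definition tensr (b : U) : UU := tens 1 b.

Lemma tensl_linear : linear tensl.
Proof. by move=> c a b; rewrite /tensl tensDl tensZl. Qed.
Lemma tensr_linear : linear tensr.
Proof. by move=> c a b; rewrite /tensr tensDr tensZr. Qed.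

HB.instance Definition _ := GRing.isLinear.Build k U UU _ tensl tensl_linear.
HB.instance Definition _ := GRing.isLinear.Build k U UU _ tensr tensr_linear.

Lemma tenslM : {morph tensl : a b / a * b}.
Proof. by move=> a b; rewrite /tensl tensM mulr1. Qed.
Lemma tensrM : {morph tensr : a b / a * b}.
Proof. by move=> a b; rewrite /tensr tensM mulr1. Qed.
Lemma tenslr a b : tensl a * tensr b = tens a b.
Proof. by rewrite /tensl /tensr tensM mul1r mulr1. Qed.
Lemma tensrl a b : tensr b * tensl a = tens a b.
Proof. by rewrite /tensl /tensr tensM mul1r mulr1. Qed.
Lemma tensl1 : tensl 1 = 1.
Proof. by rewrite /tensl /tens pgen_inl1 pgen_inr1 mulr1. Qed.
Lemma tensr1 : tensr 1 = 1.
Proof. exact: tensl1. Qed.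

Lemma uder_leibniz (d : derivation L) : leibniz (uder d).
Proof. exact: uderM. Qed.

Definition lie_part n : set U := [set iota x | x in @lie_comp k L n].

Definition ker_part (d : derivation L) n : set U :=
  [set iota x | x in [set x | @lie_comp k L n x /\ d x = 0]].

Lemma alg_const_iota c x : alg_const c * (iota x : U) = iota (c *: x).
Proof. by rewrite iotaZ presented_scaleE. Qed.

Lemma lie_part_family : lie_family lie_part.
Proof.
split.
- by move=> n; exists 0; [exact: lie_comp_0|exact: iota0].
- move=> n _ _ [x xn <-] [y yn <-].
  by exists (x + y); [exact: lie_compD|exact: Defs.iotaD].
- move=> n c _ [x xn <-].
  by exists (c *: x); [exact: lie_compZ|rewrite alg_const_iota].
- move=> i j _ _ [x xi <-] [y yj <-].
  by exists (lie_br x y); [exact: lie_comp_br|exact: iota_br].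
Qed.

Lemma ker_part_family d : lie_family (ker_part d).
Proof.
split.
- by move=> n; exists 0; [split; [exact: lie_comp_0|exact: raddf0]|exact: iota0].
- move=> n _ _ [x [xn dx] <-] [y [yn dy] <-].
  exists (x + y); last exact: Defs.iotaD.
  by split; [exact: lie_compD|rewrite raddfD /= dx dy addr0].
- move=> n c _ [x [xn dx] <-].
  exists (c *: x); last by rewrite alg_const_iota.
  split; first exact: lie_compZ.
  have -> : d (c *: x) = c *: d x by exact: linearZ.
  by rewrite dx scaler0.
- move=> i j _ _ [x [xi dx] <-] [y [yj dy] <-].
  exists (lie_br x y); last exact: iota_br.
  by split; [exact: lie_comp_br|rewrite der_br dx dy lie_br0l lie_br0r addr0].
Qed.

Lemma lie_part0 a : lie_part 0 a -> a = 0.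
Proof. by move=> [x /lie_comp0 -> <-]; exact: iota0. Qed.

Lemma ucompD n a b : @ucomp k L n a -> ucomp n b -> ucomp n (a + b).
Proof. by move=> an bn; rewrite -[a]scale1r; exact: ucompP. Qed.

Lemma lie_part_ucomp n a : lie_part n a -> @ucomp k L n a.
Proof.
move=> [x xn <-]; rewrite -[iota x]mulr1 -[n]addn0.
by apply: ucompM xn _; exact: ucomp1.
Qed.

Lemma ucomp_mul n m a b : @ucomp k L n a -> ucomp m b -> ucomp (n + m) (a * b).
Proof.
move=> an bm; elim: an => {n a} [n||n p x a xn _ IH|n c a a' _ IH _ IH'].
- by rewrite mul0r; exact: ucomp0.
- by rewrite mul1r.
- by rewrite -mulrA -addnA; exact: ucompM.
- by rewrite mulrDl -pscaleAl; exact: ucompP.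
Qed.

End EnvelopingMaps.

Section Coefficients.
Variables (k : fieldType) (R : pzAlgType k).

Definition coefs (F : nat -> set R) n : set (laurentSeries R) :=
  [set x | forall m, F n (x m)].

Lemma coefs_family F : lie_family F -> lie_family (coefs F).
Proof.
move=> lF; split.
- by move=> n m; exact: lie_family0.
- by move=> n x y xn yn m; rewrite lsDE; apply: (lie_familyD lF).
- by move=> n c x xn m; rewrite ls_constM; apply: (lie_familyZ lF).
- move=> i j x y xi yj; apply: lsMB_ind; first exact: lie_family0.
    exact: lie_familyD.
  by move=> p q; apply: (lie_familyB lF).
Qed.

(** The same subspace in each degree n: the constant family is one to which the
  lemmas on [lie_family] apply. *)
Definition minus_part (n : nat) : set (laurentSeries R) :=
  [set x | forall m, 0 <= m -> x m = 0].

Lemma minus_part_family : lie_family minus_part.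
Proof.
have minusM (x y : laurentSeries R) m : (forall m, 0 <= m -> x m = 0) ->
    (forall m, 0 <= m -> y m = 0) -> 0 <= m -> (x * y) m = 0.
  move=> x0 y0 m0; rewrite lsME; apply: fsbig1 => p _.
  have [p0|p0] := leP 0 p; first by rewrite x0 ?mul0r.
  by rewrite y0 ?mulr0 //; lia.
split=> [//|n x y x0 y0 m m0|n c x x0 m m0|i j x y x0 y0 m m0].
- by rewrite lsDE x0 ?y0 ?addr0.
- by rewrite ls_constM x0 ?mulr0.
- by rewrite lsBE !minusM ?subr0.
Qed.

End Coefficients.

(** * Inverting d + eps delta on Lie elements *)

Section Solve.
Variables (k : fieldType) (L : graded_lie k) (d delta : derivation L).
Hypothesis d_split : ker_im_split d.
Hypothesis ker_stable : forall x, kerL d x -> kerL d (der_k delta x).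
Hypothesis delta_inv : set_bij (kerL d) (kerL d) (der_k delta).

Notation U := (presented (@urel k L)).

(** The hypotheses bear on the completion; embedding each L_n in it makes them
  available degree by degree. *)
Let single n (x : L) : nat -> L := fun i => if i == n then x else 0.

Let singleE n x : single n x n = x. Proof. by rewrite /single eqxx. Qed.

Let single_compl n x : lie_comp n x -> compl (@lie_comp k L) (single n x).
Proof.
by move=> xn i; rewrite /single; case: eqP => [->//|_]; exact: lie_comp_0.
Qed.

Let single_ker n x : lie_comp n x -> d x = 0 -> kerL d (single n x).
Proof.
move=> xn dx; split; first exact: single_compl.
apply/funext => i; rewrite /der_k /single.
by case: eqP => _; rewrite ?dx ?raddf0.
Qed.

Lemma split_comp n x : lie_comp n x -> exists y z,
  [/\ lie_comp n y, d y = 0, lie_comp n z & x = y + d z].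
Proof.
move=> /single_compl /(proj1 d_split) [y [z [[Ly dy] Lz xyz]]].
exists (y n), (z n); split=> //; last by rewrite -[x in LHS](singleE n) xyz.
exact: (congr1 (fun f : nat -> L => f n) dy).
Qed.

Lemma ker_im0 n x : lie_comp n x -> d (d x) = 0 -> d x = 0.
Proof.
move=> xn ddx; rewrite -[d x](singleE n).
suff -> : single n (d x) = 0 by [].
have : (kerL d `&` der_k d @` compl (@lie_comp k L)) (single n (d x)).
  split; first by apply: single_ker => //; exact: der_comp.
  exists (single n x); first exact: single_compl.
  apply/funext => i; rewrite /der_k /single.
  by case: eqP => _; rewrite ?raddf0.
by rewrite (proj2 d_split).
Qed.

Lemma delta_ker n x : lie_comp n x -> d x = 0 -> d (delta x) = 0.
Proof.
move=> xn dx; have [_ e] := ker_stable (single_ker xn dx).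
by have := congr1 (fun f : nat -> L => f n) e; rewrite /der_k singleE.
Qed.

Lemma delta_surj n y : lie_comp n y -> d y = 0 ->
  exists x, [/\ lie_comp n x, d x = 0 & delta x = y].
Proof.
move=> yn dy; have [_ _ surj] := delta_inv.
have [x [Lx dx] xy] := surj _ (single_ker yn dy).
exists (x n); split=> //; first exact: (congr1 (fun f : nat -> L => f n) dx).
by have := congr1 (fun f : nat -> L => f n) xy; rewrite /der_k singleE.
Qed.

Lemma delta_inj0 n x : lie_comp n x -> d x = 0 -> delta x = 0 -> x = 0.
Proof.
move=> xn dx deltax; have [_ inj _] := delta_inv.
have k0 : kerL d 0.
  split; first by move=> i; exact: lie_comp_0.
  by apply/funext => i; rewrite /der_k raddf0.
have /(congr1 (fun f : nat -> L => f n)) : single n x = 0.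
  apply: inj; rewrite ?inE //; first exact: single_ker.
  apply/funext => i; rewrite /der_k /single.
  by case: eqP => _; rewrite ?deltax ?raddf0.
by rewrite singleE.
Qed.

(** An element of L_n that is zero in U is killed by d and by delta, and delta
  is injective on ker d. *)
Lemma iota_inj n (x y : L) : lie_comp n x -> lie_comp n y -> iota x = iota y -> x = y.
Proof.
move=> xn yn xy; apply/eqP; rewrite -subr_eq0; apply/eqP.
have xy0 : iota (x - y) = 0.
  by rewrite Defs.iotaD -scaleN1r iotaZ scaleN1r xy subrr.
apply: (@delta_inj0 n); first exact: lie_compB.
  exact: iota_eq0_der.
exact: iota_eq0_der.
Qed.

(** By injectivity of L_n -> U, d(x) itself lies in ker d, which meets d(L)
  in 0. *)
Lemma kernel_lift n (x : L) : lie_comp n x -> ker_part d n (iota (d x)) -> d x = 0.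
Proof.
move=> xn [y [yn dy] yx]; apply: ker_im0 (xn) _.
by rewrite -(iota_inj yn (der_comp d xn) yx).
Qed.

Lemma ker_part_delta n a : ker_part d n a -> ker_part d n (uder delta a).
Proof.
move=> [x [xn dx] <-]; exists (delta x); last by rewrite uder_iota.
by split; [exact: der_comp|exact: delta_ker xn dx].
Qed.

(** One looks for x_j = e_j + b_j with e_j in ker d. Splitting
  z_j - delta(b_j) = p_j + d(b_{j+1}) along L = ker d (+) d(L) defines b
  recursively, and e_j is the preimage of p_j under delta on ker d. *)
Lemma solve_comp n (z : nat -> L) : (forall j, lie_comp n (z j)) ->
  exists x : nat -> L, [/\ forall j, lie_comp n (x j), d (x 0%N) = 0 &
    forall j, d (x j.+1) + delta (x j) = z j].
Proof.
move=> zn.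
have /choice [f fP] : forall x, exists yz : L * L, lie_comp n x ->
    [/\ lie_comp n yz.1, d yz.1 = 0, lie_comp n yz.2 & x = yz.1 + d yz.2].
  move=> x; case: (pselect (lie_comp n x)) => [/split_comp|nx]; last by exists 0.
  by move=> [y [y' yP]]; exists (y, y').
have /choice [g gP] : forall y, exists x, lie_comp n y -> d y = 0 ->
    [/\ lie_comp n x, d x = 0 & delta x = y].
  move=> y; case: (pselect (lie_comp n y /\ d y = 0)) => [[yn dy]|ny].
    by have [x xP] := delta_surj yn dy; exists x.
  by exists 0 => yn dy; case: ny.
pose b := fix b j := if j is i.+1 then (f (z i - delta (b i))).2 else 0.
have bn j : lie_comp n (b j).
  elim: j => [|j IHj]; first exact: lie_comp_0.
  have rn : lie_comp n (z j - delta (b j)).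
    by apply: lie_compB => //; exact: der_comp.
  by have [] := fP _ rn.
pose r j := z j - delta (b j).
have rn j : lie_comp n (r j) by apply: lie_compB => //; exact: der_comp.
exists (fun j => g (f (r j)).1 + b j).
have P j := fP _ (rn j).
have Q j : [/\ lie_comp n (g (f (r j)).1), d (g (f (r j)).1) = 0 &
               delta (g (f (r j)).1) = (f (r j)).1].
  by have [p1 p2 _ _] := P j; exact: gP.
split=> [j||j].
- by have [] := Q j => *; exact: lie_compD.
- by have [_ e _] := Q 0%N; rewrite raddfD /= e add0r raddf0.
have [_ e _] := Q j.+1; have [_ _ e'] := Q j; have [_ _ _ e''] := P j.
rewrite !raddfD /= e e' add0r addrA [d _ + _]addrC -[(f (r j)).2]/(b j.+1) in e'' *.
by rewrite -e'' /r subrK.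
Qed.

Definition eps : laurentSeries U := lmono 1 1.

Lemma epsC x : eps * x = x * eps.
Proof. by apply: lsP => m; rewrite lmono_mul lmono_mulr mul1r mulr1. Qed.

Lemma epsE x m : (eps * x) m = x (m - 1).
Proof. by rewrite lmono_mul mul1r. Qed.

Definition der_eps (x : laurentSeries U) :=
  lsmap (uder d) x + eps * lsmap (uder delta) x.

Lemma der_eps_additive : {morph der_eps : x y / x - y}.
Proof.
by move=> x y; rewrite /der_eps !raddfB mulrBr opprD addrACA.
Qed.

HB.instance Definition _ := GRing.isZmodMorphism.Build
  (laurentSeries U) (laurentSeries U) der_eps der_eps_additive.

Lemma der_eps_leibniz : leibniz der_eps.
Proof.
move=> x y; rewrite /der_eps !(lsmap_leibniz (@uder_leibniz _ _ _)) mulrDr.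
by rewrite mulrDl mulrDr !mulrA -epsC addrACA.
Qed.

(** Coefficientwise the equation is d(x_m) + delta(x_{m-1}) = y_m. The
  pole of x may exceed that of y by one, because of the part in ker d. *)
Lemma laurent_solve n (y : laurentSeries U) : coefs (@lie_part k L) n y ->
  exists2 x, coefs (@lie_part k L) n x & der_eps x = y.
Proof.
move=> yn; have [a ya] := lcoef_bounded y.
have /choice [z zP] : forall j : nat, exists z : L,
    lie_comp n z /\ iota z = y (j%:Z - a%:Z).
  by move=> j; have [z zn zy] := yn (j%:Z - a%:Z); exists z.
have zn j : lie_comp n (z j) by have [] := zP j.
have [x [xn dx0 xE]] := solve_comp zn.
(* index 0 of x is the coefficient of eps ^ (- a - 1) *)
pose c (m : int) : U :=
  if m < - a.+1%:Z then 0 else iota (x (absz (m + a.+1%:Z))).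
have c_bounded : exists a, pole_le a c by exists a.+1 => m ma; rewrite /c ma.
exists (Laurent c_bounded).
  move=> m; rewrite /= /c; case: ifP => _; first exact: (lie_family0 (lie_part_family L)).
  by exists (x (absz (m + a.+1%:Z))).
apply: lsP => m; rewrite lsDE epsE !lsmapE /= /c.
have [ma|am] := ltP m (- a.+1%:Z).
  by rewrite ifT ?raddf0 ?addr0 ?ya //; lia.
rewrite uder_iota; have [ma|{}am] := ltP m (- a%:Z).
  have -> : absz (m + a.+1%:Z) = 0%N by lia.
  by rewrite dx0 iota0 add0r ifT ?raddf0 ?ya //; lia.
rewrite ifF ?uder_iota; last by lia.
have -> : absz (m + a.+1%:Z) = (absz (m + a%:Z)).+1 by lia.
have -> : absz (m - 1 + a.+1%:Z) = absz (m + a%:Z) by lia.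
rewrite -Defs.iotaD xE; have [_ ->] := zP (absz (m + a%:Z)).
by congr (y _); lia.
Qed.

End Solve.

(** * Group-like elements *)

Section GroupLike.
Variables (k : fieldType) (char0 : [pchar k] =i pred0) (L : graded_lie k).

Notation U := (presented (@urel k L)).
Notation UU := (presented (@trel k L)).
Notation ps_coprod := (psmap (lsmap (@coprod k L))).
Notation ps_tensl := (psmap (lsmap (@tensl k L))).
Notation ps_tensr := (psmap (lsmap (@tensr k L))).
Implicit Types X Y phi w : pseries (laurentSeries U).

Lemma ps_coprodM : {morph ps_coprod : X Y / X * Y}.
Proof. exact/psmapM/lsmapM/coprodM. Qed.
Lemma ps_tenslM : {morph ps_tensl : X Y / X * Y}.
Proof. exact/psmapM/lsmapM/tenslM. Qed.
Lemma ps_tensrM : {morph ps_tensr : X Y / X * Y}.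
Proof. exact/psmapM/lsmapM/tensrM. Qed.

Lemma ps_tens_comm X Y : ps_tensl X * ps_tensr Y = ps_tensr Y * ps_tensl X.
Proof.
apply/eqP; rewrite -subr_eq0; apply/eqP; apply: psP => n.
rewrite psMBE big1 // => i _; apply: lsP => m.
apply: (@lsMB_ind _ [set 0]) => //= [_ _ -> ->|p q]; first exact: addr0.
change (tensl (X i p) * tensr (Y (n - i)%N q) -
        tensr (Y (n - i)%N q) * tensl (X i p) = 0).
by rewrite tenslr tensrl subrr.
Qed.

Lemma ps_coprod_lie w : (forall n, coefs (@lie_part k L) n (w n)) ->
  ps_coprod w = ps_tensl w + ps_tensr w.
Proof.
move=> wL; apply: psP => n; apply: lsP => m.
have [x _ xw] := wL n m.
by rewrite -[LHS]/(coprod (w n m)) -[RHS]/(tensl (w n m) + tensr (w n m)) -xw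
  coprod_iota addrC.
Qed.

(** Delta(phi) and phi (x) phi = (phi (x) 1) (1 (x) phi) both solve
  E(psi) = psi (w (x) 1 + 1 (x) w) with psi_0 = 1. *)
Lemma eul_grouplike phi w : (forall n, coefs (@lie_part k L) n (w n)) ->
  w 0 = 0 -> phi 0 = 1 -> eul phi = phi * w ->
  ps_coprod phi = ps_tensl phi * ps_tensr phi.
Proof.
move=> wL w0 phi0 Ephi; apply: (eul_uniq char0 (w := ps_coprod w)).
- by rewrite eul_psmap Ephi ps_coprodM.
- rewrite eul_leibniz !eul_psmap Ephi ps_tenslM ps_tensrM ps_coprod_lie //.
  by rewrite mulrDr -!mulrA ps_tens_comm.
- by rewrite /psmap w0 raddf0.
- have one (V : pzRingType) (f : {additive U -> V}) : f 1 = 1 -> lsmap f 1 = 1.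
    by move=> f1; apply: lsP => m; rewrite lsmapE !ls1E; case: eqP; rewrite ?raddf0.
  rewrite psM0E; change (lsmap (@coprod k L) (phi 0) =
    lsmap (@tensl k L) (phi 0) * lsmap (@tensr k L) (phi 0)).
  by rewrite phi0 !one ?mulr1 //; [exact: tensr1|exact: tensl1|exact: coprod1].
Qed.

End GroupLike.

(** * Power series of Laurent series as coefficient functions *)

Section Dictionary.
Variable (k : fieldType).

Definition ps_coef (V : zmodType) (X : pseries (laurentSeries V)) :
  nat -> int -> V := fun n m => X n m.

Lemma ps_coef_inj (V : zmodType) : injective (@ps_coef V).
Proof.
move=> X Y XY; apply/funext => n; apply: lsP => m.
exact: (congr1 (fun x : nat -> int -> V => x n m) XY).
Qed.

Lemma laurent_ps (V : lmodType k) gr (x : nat -> int -> V) : laurent gr x ->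
  exists2 X, x = ps_coef X & forall n m, gr n (X n m).
Proof.
move=> lx; have b n : exists a, pole_le a (x n).
  by have [_ [N xN]] := lx n; exists (absz N) => m mN; apply: xN; lia.
exists (fun n => Laurent (b n)); first by [].
by move=> n; have [xn _] := lx n.
Qed.

Lemma ps_laurent (V : lmodType k) gr (X : pseries (laurentSeries V)) :
  (forall n m, gr n (X n m)) -> laurent gr (ps_coef X).
Proof.
move=> Xgr n; split; first exact: Xgr; have [a Xa] := lcoef_bounded (X n).
by exists (- a%:Z).
Qed.

Variable L : graded_lie k.
Notation U := (presented (@urel k L)).
Implicit Types X Y : pseries (laurentSeries U).

Lemma ua_mulE X Y : ua_mul (ps_coef X) (ps_coef Y) = ps_coef (X * Y).
Proof.
by apply/funext => n; apply/funext => m; rewrite /ps_coef psME ls_sumE.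
Qed.

Lemma ua_oneE : @ua_one k L = ps_coef 1.
Proof.
apply/funext => n; apply/funext => m; rewrite /ps_coef ps1E /ua_one.
by case: n.
Qed.

Lemma convA_tensE X : convA (@tens k L) (ps_coef X) (ps_coef X) =
  ps_coef (psmap (lsmap (@tensl k L)) X * psmap (lsmap (@tensr k L)) X).
Proof.
apply/funext => n; apply/funext => m; rewrite /ps_coef psME ls_sumE.
apply: eq_bigr => i _; rewrite lsME; apply: eq_fsbigr => p _.
by rewrite -tenslr.
Qed.

Lemma ua_expE X : ua_exp (ps_coef X) = ps_coef (pexp X).
Proof.
apply/funext => n; apply/funext => m; rewrite /ps_coef /pexp ls_sumE.
apply: eq_bigr => r _; rewrite ps_constM ls_constM presented_scaleE; congr (_ * _).
suff -> : iter r (ua_mul (ps_coef X)) (@ua_one k L) = ps_coef (X ^+ r) by [].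
elim: (r : nat) => [|s IHs] /=; first by rewrite ua_oneE expr0.
by rewrite IHs ua_mulE exprS.
Qed.

End Dictionary.

(** * Elements with a Lie logarithmic derivative *)

Section GroupElements.
Variables (k : fieldType) (char0 : [pchar k] =i pred0) (L : graded_lie k).
Notation U := (presented (@urel k L)).
Implicit Types X Y phi w : pseries (laurentSeries U).

Lemma eul_ucomp phi w : (forall n, coefs (@lie_part k L) n (w n)) ->
  w 0 = 0 -> phi 0 = 1 -> eul phi = phi * w ->
  forall n m, ucomp n (phi n m).
Proof.
move=> wL w0 phi0 Ephi; elim/ltn_ind => -[|n] IHn m.
  rewrite phi0 ls1E; case: eqP => _; first exact: ucomp1.
  exact: ucomp0.
have Pn : ucomp n.+1 (phi n.+1 m *+ n.+1).
  rewrite -lsMnE -[_ *+ _]/(eul phi n.+1) Ephi psME ls_sumE.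
  apply: (big_ind (@ucomp k L n.+1)); first exact: ucomp0.
    exact: ucompD.
  move=> i _; have /ltnSE := ltn_ord i; rewrite leq_eqVlt => /orP[/eqP ->|lin].
    by rewrite subnn w0 mulr0; exact: ucomp0.
  apply: lsM_ind; [exact: ucomp0|exact: ucompD|move=> p q].
  have := ucomp_mul (IHn i lin p) (lie_part_ucomp (wL (n.+1 - i)%N q)).
  by rewrite subnKC // ltnW.
rewrite -(alg_const_nat char0 n (phi n.+1 m)) -mulrnAr -presented_scaleE -[_ *: _]addr0.
exact: ucompP Pn (ucomp0 _ _).
Qed.

Lemma eul_GA phi w : (forall n, coefs (@lie_part k L) n (w n)) ->
  w 0 = 0 -> phi 0 = 1 -> eul phi = phi * w -> GA (ps_coef phi).
Proof.
move=> wL w0 phi0 Ephi; split.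
- by apply: ps_laurent; exact: eul_ucomp Ephi.
- by rewrite ua_oneE /ps_coef phi0.
move=> n m; rewrite convA_tensE -(eul_grouplike char0 wL) //.
Qed.

Lemma coefs_lie0 X : (forall n, coefs (@lie_part k L) n (X n)) -> X 0 = 0.
Proof. by move=> XL; apply: lsP => m; exact: lie_part0 (XL 0%N m). Qed.

Lemma pexp0 X : pexp X 0 = 1.
Proof. by rewrite /pexp big_ord1 fact0 invr1 rmorph1 mul1r expr0. Qed.

Lemma pexp_eul X : (forall n, coefs (@lie_part k L) n (X n)) ->
  exists w, [/\ forall n, coefs (@lie_part k L) n (w n), w 0 = 0 &
                eul (pexp X) = pexp X * w].
Proof.
move=> XL; have X0 := coefs_lie0 XL.
have fam := coefs_family (lie_part_family L).
have EX0 : eul X 0 = 0 by [].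
have wL : forall n, coefs (@lie_part k L) n (logder X (eul X) n).
  apply: (logder_family fam) => // n; exact: (lie_family_muln fam).
exists (logder X (eul X)); split=> //; first exact: coefs_lie0.
apply: (pexp_logder char0 (D := @eul (laurentSeries U))) => //.
- exact: eul_leibniz.
- by move=> Y Z n YZ; rewrite /= /eul YZ.
Qed.

End GroupElements.

(** * Existence of a solution *)

Section Existence.
Variables (k : fieldType) (char0 : [pchar k] =i pred0) (L : graded_lie k).
Variables (d delta : derivation L).
Hypothesis d_split : ker_im_split d.
Hypothesis delta_inv : set_bij (kerL d) (kerL d) (der_k delta).
Notation U := (presented (@urel k L)).
Notation S := (laurentSeries U).
Notation D := (psmap (der_eps d delta)).

Lemma der_epsE (X : pseries S) :
  uder_A d (ps_coef X) + eps_mul 1 (uder_A delta (ps_coef X)) = ps_coef (D X).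
Proof.
apply/funext => n; apply/funext => m.
change (uder d (X n m) + uder delta (X n (m - 1)) = (der_eps d delta (X n)) m).
by rewrite /der_eps lsDE epsE.
Qed.

Definition const_series (u : nat -> L) : pseries S := fun n => lmono 0 (iota (u n) : U).

Lemma const_series_lie u : compl (@lie_comp k L) u ->
  forall n, coefs (@lie_part k L) n (const_series u n).
Proof.
move=> Lu n m; rewrite lmonoE; case: eqP => _; first by exists (u n).
exact: (lie_family0 (lie_part_family L)).
Qed.

(** w solves D(w) = E(u) + [w, u], the zero-curvature relation for the
  equations E(phi) = phi w and D(phi) = phi u. *)
Lemma exists_solution u : compl (@lie_comp k L) u ->
  exists2 phi, GA (ps_coef phi) & D phi = phi * const_series u.
Proof.
move=> Lu; pose V := const_series u.
have VL n : coefs (@lie_part k L) n (V n) by exact: const_series_lie.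
have V0 : V 0 = 0 by exact: coefs_lie0.
have fam := coefs_family (lie_part_family L).
have /choice [s sP] : forall n, exists s : S -> S,
    forall y, coefs (@lie_part k L) n (s y) /\
      (coefs (@lie_part k L) n y -> der_eps d delta (s y) = y).
  move=> n; suff /choice [s sP] : forall y, exists x : S,
      coefs (@lie_part k L) n x /\
      (coefs (@lie_part k L) n y -> der_eps d delta x = y) by exists s.
  move=> y; case: (pselect (coefs (@lie_part k L) n y)) => [yn|ny].
    by have [x xn xy] := laurent_solve d_split delta_inv yn; exists x.
  by exists 0; split=> //; exact: (lie_family0 fam).
have [w wE] : exists w : nat -> S,
    forall n, w n = s n ((eul V + ((w : pseries S) * V - V * (w : pseries S))) n).
  apply: (causal_fixpoint (0 : S)) => n x y xy; congr (s n _).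
  rewrite [LHS]psDE [RHS]psDE !psMBE; congr (_ + _); apply: eq_bigr => i _.
  have /ltnSE := ltn_ord i; rewrite leq_eqVlt => /orP[/eqP ->|lin]; last by rewrite xy.
  by rewrite subnn V0 !mulr0 !mul0r.
have wL n : coefs (@lie_part k L) n (w n).
  by rewrite wE; have [] := sP n ((eul V + ((w : pseries S) * V - V * (w : pseries S))) n).
have w0 : w 0%N = 0 by exact: coefs_lie0.
have Dw : D w = eul V + ((w : pseries S) * V - V * (w : pseries S)).
  apply: psP => n; rewrite -[LHS]/(der_eps d delta (w n)) wE.
  apply: (proj2 (sP n _)); rewrite psDE; apply: (lie_familyD fam).
    exact: (lie_family_muln fam).
  exact: (lie_family_comm fam).
have [phi phiE] : exists phi : nat -> S, forall n, phi n =
    if n is m.+1 then alg_const (m.+1%:R : k)^-1 * ((phi : pseries S) * (w : pseries S)) n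
    else 1.
  apply: (causal_fixpoint (0 : S)) => -[//|n] x y xy; congr (_ * _).
  rewrite !psME; apply: eq_bigr => i _.
  have /ltnSE := ltn_ord i; rewrite leq_eqVlt => /orP[/eqP ->|lin]; last by rewrite xy.
  by rewrite subnn w0 !mulr0.
have phi0 : phi 0%N = 1 by rewrite phiE.
have Ephi : eul phi = (phi : pseries S) * (w : pseries S).
  apply: psP => -[|n]; first by rewrite psM0E w0 mulr0.
  by rewrite /eul phiE (alg_const_nat char0).
exists phi; first exact: (eul_GA char0 wL).
apply: (zero_curvature char0 (w := w)) => //.
- exact/psmap_leibniz/der_eps_leibniz.
- by move=> X; exact: eul_psmap.
- change (eul V = D w + (V * (w : pseries S)) - (w : pseries S) * V).
  by rewrite Dw addrA subrK addrK.
- rewrite -[X in _ = _ * X]/(V 0%N) V0 mulr0 -[LHS]/(der_eps d delta (phi 0%N)) phi0.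
  exact/leibniz1/der_eps_leibniz.
Qed.

End Existence.

(** * Series without poles *)

Section PlusPart.
Variables (k : fieldType) (R : pzAlgType k).
Implicit Types (x y : laurentSeries R) (X Y : pseries (laurentSeries R)).

Lemma pole0_sum I (r : seq I) (F : I -> laurentSeries R) :
  (forall i, pole_le 0 (F i)) -> pole_le 0 (\sum_(i <- r) F i).
Proof. by move=> F0 m m0; rewrite ls_sumE big1 // => i _; exact: F0. Qed.

Lemma pole0_mul x y : pole_le 0 x -> pole_le 0 y -> pole_le 0 (x * y).
Proof. exact: pole_leM. Qed.

Lemma pole0_psM X Y : (forall n, pole_le 0 (X n)) -> (forall n, pole_le 0 (Y n)) ->
  forall n, pole_le 0 ((X * Y) n).
Proof.
by move=> X0 Y0 n; rewrite psME; apply: pole0_sum => i; exact: pole0_mul.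
Qed.

Lemma pole0_pexp X : (forall n, pole_le 0 (X n)) -> forall n, pole_le 0 (pexp X n).
Proof.
move=> X0; have Xr r n : pole_le 0 ((X ^+ r) n).
  elim: r n => [|r IHr] n; last by rewrite exprS; exact: pole0_psM.
  by rewrite expr0 ps1E; case: eqP => // _; exact: pole_ls1.
move=> n; apply: pole0_sum => r m m0.
by rewrite ps_constM ls_constM Xr ?mulr0.
Qed.

Lemma psM_lreg X Y : X 0 = 1 -> X * Y = 0 -> Y = 0.
Proof.
move=> X0 XY; apply: psP => n; elim/ltn_ind: n => n IHn.
have := congr1 (fun Z : pseries (laurentSeries R) => Z n) XY.
rewrite psME big_ord_recl X0 mul1r subn0 big1 ?addr0 // => i _.
by rewrite IHn ?mulr0 //= /bump /=; have := ltn_ord i; lia.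
Qed.

(** Y_n is (Y X)_n minus terms that involve the Y_i with i < n. *)
Lemma pole0_cancel X Y : X 0 = 1 -> (forall n, pole_le 0 (X n)) ->
  (forall n, pole_le 0 ((Y * X) n)) -> forall n, pole_le 0 (Y n).
Proof.
move=> X1 X0 YX; elim/ltn_ind => n IHn m m0.
have := YX n m m0; rewrite psME big_ord_recr subnn X1 mulr1 lsDE ls_sumE.
by rewrite big1 ?add0r // => i _; apply: pole0_mul m m0; [exact: IHn (ltn_ord i)|exact: X0].
Qed.

Lemma logder0 X : logder X 0 = 0.
Proof.
apply: psP => n; rewrite /logder big1 // => r _.
suff -> : logder_term X 0 r = 0 by [].
by elim: (r : nat) => //= s ->; rewrite mul0r mulr0 subrr mulr0.
Qed.

End PlusPart.

(** * The Birkhoff factors of a solution *)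

Section Renormalization.
Variables (k : fieldType) (char0 : [pchar k] =i pred0) (L : graded_lie k).
Variables (d delta : derivation L).
Hypothesis d_split : ker_im_split d.
Hypothesis ker_stable : forall x, kerL d x -> kerL d (der_k delta x).
Hypothesis delta_inv : set_bij (kerL d) (kerL d) (der_k delta).
Notation U := (presented (@urel k L)).
Notation S := (laurentSeries U).
Notation D := (psmap (der_eps d delta)).
Notation dS := (psmap (lsmap (uder d))).
Notation deltaS := (psmap (lsmap (uder delta))).
Notation eps := (@eps k L).

Lemma pexp_uder (e : derivation L) (X : pseries S) :
  (forall n, coefs (@lie_part k L) n (X n)) ->
  psmap (lsmap (uder e)) (pexp X) =
  pexp X * logder X (psmap (lsmap (uder e)) X).
Proof.
move=> XL; have X0 := coefs_lie0 XL.
apply: (pexp_logder char0 (D := psmap (lsmap (uder e)))) => //.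
- exact/psmap_leibniz/lsmap_leibniz/uder_leibniz.
- by move=> Y Z n YZ; rewrite /= /psmap YZ.
- by rewrite /= /psmap X0 raddf0.
Qed.

Section Counterterm.
Variable X : pseries S.
Hypothesis X_lie : forall n, coefs (@lie_part k L) n (X n).
Hypothesis X_minus : forall n m, 0 <= m -> X n m = 0.

Let a := logder X (dS X).
Let b := logder X (deltaS X).

(** The logarithmic derivative of the counterterm exp(X) with respect to
  d + eps delta. For the counterterm of a solution it is a constant in eps, the
  normal form of u. *)
Definition beta_series : pseries S := a + psC eps * b.

Lemma beta_seriesE n m : beta_series n m = a n m + b n (m - 1).
Proof. by rewrite /beta_series psDE psC_mul lsDE epsE. Qed.

Lemma pexp_der_eps : D (pexp X) = pexp X * beta_series.
Proof.
have epsM Y Z : Y * (psC eps * Z) = psC eps * (Y * Z) :> pseries S.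
  rewrite !mulrA; congr (_ * _).
  by apply: psP => n; rewrite psC_mul psC_mulr epsC.
rewrite /beta_series mulrDr epsM -!pexp_uder //.
by apply: psP => n; rewrite psDE psC_mul.
Qed.

Lemma beta_series_pos n m : 0 < m -> beta_series n m = 0.
Proof.
have fam := minus_part_family U.
have X0 := coefs_lie0 X_lie.
have minus (e : derivation L) i :
    minus_part 0 (logder X (psmap (lsmap (uder e)) X) i).
  apply: (logder_family fam) => //; first by rewrite /psmap X0 raddf0.
  by move=> j p p0; rewrite -[LHS]/(uder e (X j p)) X_minus // raddf0.
by move=> m0; rewrite beta_seriesE /a /b !minus ?addr0 //; lia.
Qed.

Hypothesis beta_pole : forall n, pole_le 0 (beta_series n).

(** Induction on n, and on m from the pole of X_n upwards: modulo ker d, the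
  vanishing of the coefficient of eps^m in [beta_series] reads d(X_{n,m}) =
  - delta(X_{n,m-1}). *)
Lemma counterterm_ker n : coefs (ker_part d) n (X n).
Proof.
have kfam := ker_part_family d; have fam := coefs_family kfam.
have X0 := coefs_lie0 X_lie.
elim/ltn_ind: n => n IHn.
have tail (e : derivation L) :
    (forall i m, ker_part d i (X i m) -> ker_part d i (uder e (X i m))) ->
    coefs (ker_part d) n ((logder X (psmap (lsmap (uder e)) X) -
                           psmap (lsmap (uder e)) X) n).
  move=> ek; apply: (logder_tail_family fam) => //.
    by rewrite /psmap X0 raddf0.
  by move=> i lin m; apply: ek; exact: IHn.
have dtail := tail d; have deltatail := tail delta.
have step m : m < 0 -> ker_part d n (X n (m - 1)) -> ker_part d n (X n m).
  move=> m0 Xm1.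
  have da : ker_part d n (a n m - uder d (X n m)).
    apply: dtail => i p [x [xi dx] <-]; rewrite uder_iota dx iota0.
    exact: lie_family0.
  have db : ker_part d n (b n (m - 1) - uder delta (X n (m - 1))).
    by apply: deltatail => i p; exact: (ker_part_delta ker_stable).
  have b1 : ker_part d n (b n (m - 1)).
    rewrite -[b n _](subrK (uder delta (X n (m - 1)))).
    by apply: (lie_familyD kfam) => //; exact: (ker_part_delta ker_stable).
  have ab : a n m = - b n (m - 1).
    apply/eqP; rewrite -addr_eq0 -beta_seriesE; apply/eqP.
    exact: beta_pole.
  have dX : ker_part d n (uder d (X n m)).
    rewrite -[uder d _](subKr (a n m)); apply: (lie_familyD kfam).
      by rewrite ab; exact: (lie_familyN kfam).
    exact: (lie_familyN kfam).
  have [x xn xX] := X_lie n m; exists x => //; split=> //.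
  rewrite -xX uder_iota in dX.
  exact: (kernel_lift d_split delta_inv xn dX).
(* j = 0 is the index just below the lowest possible coefficient *)
have [p Xp] := lcoef_bounded (X n).
have up j : ker_part d n (X n (j%:Z - p%:Z - 1)).
  elim: j => [|j IHj].
    by rewrite Xp; [exact: (lie_family0 kfam)|lia].
  have [j0|j0] := ltP (j.+1%:Z - p%:Z - 1) 0; last first.
    by rewrite X_minus //; exact: (lie_family0 kfam).
  apply: step => //; rewrite (_ : _ - 1 - 1 = j%:Z - p%:Z - 1) //; lia.
move=> m; have [mp|pm] := ltP m (- p%:Z).
  by rewrite Xp //; exact: (lie_family0 kfam).
have -> : m = (absz (m + p%:Z + 1))%:Z - p%:Z - 1 by lia.
exact: up.
Qed.

(** Since X is in ker d, exp(X) is killed by d, and [beta_series] reduces to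
  eps times the logarithmic derivative for delta. *)
Lemma counterterm_beta : exists2 beta : nat -> L, kerL d beta &
  beta_series = const_series beta /\
  deltaS (pexp X) = pexp X * (fun n => lmono (-1) (iota (beta n) : U)).
Proof.
have kfam := ker_part_family d; have fam := coefs_family kfam.
have XK := counterterm_ker; have X0 := coefs_lie0 X_lie.
have a0 : a = 0.
  rewrite /a (_ : dS X = 0) ?logder0 //.
  apply: psP => n; apply: lsP => m; have [x [_ dx] xX] := XK n m.
  by rewrite -[LHS]/(uder d (X n m)) -xX uder_iota dx iota0.
have bK n : coefs (ker_part d) n (b n).
  apply: (logder_family fam) => //; first by rewrite /psmap X0 raddf0.
  by move=> i m; apply: (ker_part_delta ker_stable); exact: XK.
have /choice [beta betaP] : forall n, exists x : L,
    [/\ lie_comp n x, d x = 0 & iota x = b n (-1)].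
  by move=> n; have [x [xn dx] xb] := bK n (-1); exists x.
have bE n m : b n m = if m == -1 then iota (beta n) else 0.
  have [->|mN1] := eqVneq m (-1); first by have [_ _ ->] := betaP n.
  have := beta_seriesE n (m + 1); rewrite a0 add0r addrK => <-.
  have [m0|m0] := ltP (m + 1) 0; first exact: beta_pole.
  by apply: beta_series_pos; lia.
exists beta.
  split=> [n|]; first by have [] := betaP n.
  by apply/funext => n; have [_ e _] := betaP n.
split.
  apply: psP => n; apply: lsP => m; rewrite beta_seriesE a0 add0r bE lmonoE.
  by rewrite subr_eq addNr.
rewrite pexp_uder //; congr (_ * _); apply: psP => n; apply: lsP => m.
exact: bE.
Qed.

End Counterterm.

(** The equation of a solution, divided on the left by exp(X). *)
Lemma renormalized_eq (X Y V : pseries S) :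
  (forall n, coefs (@lie_part k L) n (X n)) ->
  D (pexp X * pexp Y) = pexp X * pexp Y * V ->
  beta_series X * pexp Y + D (pexp Y) = pexp Y * V.
Proof.
move=> XL DXY; apply/eqP; rewrite -subr_eq0; apply/eqP.
apply: (psM_lreg (pexp0 X)); rewrite mulrBr mulrDr !mulrA -DXY -pexp_der_eps //.
by rewrite (psmap_leibniz (@der_eps_leibniz _ _ d delta)) subrr.
Qed.

Lemma der_eps_pole0 (x : S) : pole_le 0 x -> pole_le 0 (der_eps d delta x).
Proof.
move=> x0 m m0; rewrite /der_eps lsDE epsE.
by rewrite !(@pole_lsmap _ _ _ 0) ?addr0 //; lia.
Qed.

Lemma beta_series_pole0 (X Y V : pseries S) :
  (forall n, coefs (@lie_part k L) n (X n)) ->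
  (forall n, pole_le 0 (Y n)) -> (forall n, pole_le 0 (V n)) ->
  D (pexp X * pexp Y) = pexp X * pexp Y * V ->
  forall n, pole_le 0 (beta_series X n).
Proof.
move=> XL Y0 V0 /(renormalized_eq XL) e; have P0 := pole0_pexp Y0.
apply: (pole0_cancel (pexp0 Y)) => // n m m0.
rewrite -[_ * _](addrK (D (pexp Y))) e psBE lsBE.
by rewrite (pole0_psM P0 V0) // der_eps_pole0 ?subr0.
Qed.

End Renormalization.

(** * Evaluation at eps = 0 *)

Section Evaluation.
Variables (k : fieldType) (char0 : [pchar k] =i pred0) (L : graded_lie k).
Notation U := (presented (@urel k L)).
Notation S := (laurentSeries U).
Implicit Types X Y phi : pseries S.

Lemma eval0M X Y : (forall n, pole_le 0 (X n)) -> (forall n, pole_le 0 (Y n)) ->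
  eval0 (ps_coef (X * Y)) = uk_mul (eval0 (ps_coef X)) (eval0 (ps_coef Y)).
Proof.
move=> X0 Y0; apply/funext => n; rewrite /eval0 /ps_coef psME ls_sumE.
by apply: eq_bigr => i _; rewrite lsM_coef0.
Qed.

Lemma eval0_Gk phi : GA (ps_coef phi) -> (forall n, pole_le 0 (phi n)) ->
  Gk (eval0 (ps_coef phi)).
Proof.
move=> [phiU phi1 phiD] phi0; split.
- by move=> n; have [gr _] := phiU n; exact: gr.
- exact: (congr1 (fun f : int -> U => f 0) phi1).
move=> n; rewrite [LHS]phiD convA_tensE /ps_coef psME ls_sumE.
apply: eq_bigr => i _; rewrite lsM_coef0 ?tenslr //; exact: pole_lsmap.
Qed.

End Evaluation.

Theorem theorem5 (k : fieldType) (char0 : [pchar k] =i pred0)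
  (L : graded_lie k) (d delta : derivation L)
  (d_split : ker_im_split d)
  (ker_stable : forall x, kerL d x -> kerL d (der_k delta x))
  (delta_inv : set_bij (kerL d) (kerL d) (der_k delta))
  (u : nat -> L) (Lu : compl (@lie_comp k L) u) :
  let solution (phi : nat -> int -> presented (@urel k L)) :=
    GA phi /\
    uder_A d phi + eps_mul 1 (uder_A delta phi) =
      ua_mul phi (eps_const 0 (iota_k u)) in
  (exists phi, solution phi) /\
  (forall phi phim phip, solution phi -> birkhoff phi phim phip ->
    exists beta : nat -> L,
      [/\ kerL d beta,
          d_conjugates d (eval0 phip) u beta &
          uder_A delta phim =
            ua_mul phim (eps_const (-1) (iota_k beta))]).
Proof.
move=> solution; have constE : eps_const 0 (iota_k u) = ps_coef (const_series u).
  by [].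
split.
  have [phi phiG Dphi] := exists_solution char0 d_split delta_inv Lu.
  by exists (ps_coef phi); split=> //; rewrite der_epsE Dphi constE ua_mulE.
move=> phi _ _ [_ Dphi] [[x [xL x_minus] <-] [y [yL y_plus] <-] phiE].
have lift (z : nat -> int -> L) : laurent (@lie_comp k L) z ->
    exists2 Z, iota_A z = ps_coef Z & forall n, coefs (@lie_part k L) n (Z n).
  move=> /laurent_ps[Z -> ZL].
  exists (fun n => lsmap (@iota k L) (Z n)) => // n m.
  by exists (Z n m).
have [X xE XL] := lift x xL; have [Y yE YL] := lift y yL.
have X_minus n m : 0 <= m -> X n m = 0.
  move=> m0; rewrite -[X n m]/(ps_coef X n m) -xE /iota_A x_minus //; exact: iota0.
have Y0 n : pole_le 0 (Y n).
  move=> m m0; rewrite -[Y n m]/(ps_coef Y n m) -yE /iota_A y_plus; first exact: iota0.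
  by rewrite oppr0 in m0.
have V0 n : pole_le 0 (const_series u n).
  by move=> m m0; rewrite lmonoE; case: eqP => // m0'; rewrite m0' in m0.
rewrite xE yE !ua_expE ua_mulE in phiE *.
rewrite phiE constE der_epsE ua_mulE in Dphi.
have {}Dphi := ps_coef_inj Dphi.
have z0 := beta_series_pole0 char0 XL Y0 V0 Dphi.
have [beta betaK [zE deltaX]] :=
  counterterm_beta char0 d_split ker_stable delta_inv XL X_minus z0.
exists beta; split=> //; last first.
  change (ps_coef (psmap (lsmap (uder delta)) (pexp X)) =
    ua_mul (ps_coef (pexp X)) (ps_coef (fun n => lmono (-1) (iota (beta n) : presented _)))).
  by rewrite deltaX ua_mulE.
have P0 := pole0_pexp Y0.
split.
  have [w [wL w0 Ew]] := pexp_eul char0 YL.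
  by apply: eval0_Gk => //; apply: (eul_GA char0 wL) => //; exact: pexp0.
have := renormalized_eq char0 XL Dphi; rewrite zE => e.
have := congr1 (fun Z => eval0 (ps_coef Z)) e; rewrite eval0M // => <-.
have beta0 n : pole_le 0 (const_series beta n) by rewrite -zE.
rewrite (_ : uk_mul (iota_k beta) _ = eval0 (ps_coef (const_series beta * pexp Y))).
  rewrite addrC; apply/funext => n.
  change ((const_series beta * pexp Y) n 0 + uder d (pexp Y n 0) =
    (const_series beta * pexp Y) n 0 + (der_eps d delta (pexp Y n)) 0).
  rewrite /der_eps lsDE epsE.
  suff -> : lsmap (uder delta) (pexp Y n) (0 - 1) = 0 by rewrite addr0.
  exact: (@pole_lsmap _ _ _ 0).
by rewrite eval0M.
Qed.
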